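(* Let $d\ge 0$ and let $U\in\mathrm{Rep}_{\mathbb{Q}}^d$ with $\mathrm{ch}_0(U)\neq 0$. Then for each $k\in\{2,3\}$ there is a polynomial $f^{(k)}_U\in\mathbb{Q}[x]$ of degree at most $d-1$ such that $$\mathsf{d}_k(U)=f^{(k)}_U(r)\,\mathsf{d}_k(V).$$
   Context: Let $V$ be a complex vector space of dimension $r\ge1$ and $\mathrm{GL}_r=\mathrm{GL}(V)$. $\mathrm{Rep}_{\mathbb{Q}}$ is the Grothendieck ring of finite-dimensional polynomial representations of $\mathrm{GL}_r$ tensored with $\mathbb{Q}$ (sum induced by direct sum, product by tensor product). It has as $\mathbb{Q}$-basis the Schur representations $\mathbf{S}^\alpha V$ (irreducible polynomial representation of highest weight $\alpha$), $\alpha=(\alpha_1\ge\dots\ge\alpha_r\ge0)$; $\mathrm{Rep}_{\mathbb{Q}}^d$ is the span of those with $|\alpha|=\sum_i\alpha_i=d$. The character $\mathrm{Char}(W)=\sum_\lambda \dim W(\lambda)\,q^\lambda\in\mathbb{Z}[q_1,\dots,q_r]$ ($W(\lambda)$ the weight spaces for the diagonal torus) extends to a $\mathbb{Q}$-algebra homomorphism $\mathrm{Rep}_{\mathbb{Q}}\to\mathbb{Q}[q_1,\dots,q_r]$. The Chern character $\mathrm{ch}:\mathrm{Rep}_{\mathbb{Q}}\to\mathbb{Q}[[a_1,\dots,a_r]]$ is obtained by substituting $q_i\mapsto e^{a_i}$ in $\mathrm{Char}$; $\mathrm{ch}_k(U)$ is the homogeneous degree $k$ part of $\mathrm{ch}(U)$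 (so $\mathrm{ch}_0(U)=\dim U$). Set $\Delta_2(U)=\mathrm{ch}_1(U)^2-2\mathrm{ch}_0(U)\mathrm{ch}_2(U)$, $\Delta_3(U)=\mathrm{ch}_1(U)^3-3\mathrm{ch}_0(U)\mathrm{ch}_1(U)\mathrm{ch}_2(U)+3\mathrm{ch}_0(U)^2\mathrm{ch}_3(U)$, and $\mathsf{d}_k(U)=\dfrac{\Delta_k(U)}{k\,\mathrm{ch}_0(U)^{k-1}}$ whenever $\mathrm{ch}_0(U)\ne0$. A polynomial of degree at most $-1$ is the zero polynomial. *)

(* Defs.v *)
From HB Require Import structures.
From mathcomp Require Import all_boot all_order all_algebra.
From mathcomp Require Import boolp classical_sets fsbigop reals.
From mathcomp Require Import complex.
From mathcomp.multinomials Require Import freeg mpoly.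

Set Implicit Arguments.
Unset Strict Implicit.
Unset Printing Implicit Defensive.

Import Order.TTheory GRing.Theory Num.Theory.

Local Open Scope ring_scope.

(* V is C^r with C = R[i], so that GL_r is the group of invertible r x r      *)
(* matrices, acting on the left on column vectors.                            *)

(* The value at g of a matrix of polynomials in the r * r entries of g, where *)
(* 'X_(mxvec_index i j) stands for the entry g i j.                           *)
Definition eval_mx (R : realType) (r n : nat)
    (P : 'M[{mpoly (complex R)[r * r]}]_n) (g : 'M[complex R]_r) :
    'M[complex R]_n :=
  map_mx (meval (fun l => mxvec g 0 l)) P.

(* A finite-dimensional polynomial representation, in coordinates. Since GL_r *)
(* is Zariski dense in the matrices, the polynomials are determined by the    *)
(* representation, so storing them adds no structure.                         *)
Record polyrep (R : realType) (r : nat) := PolyRep {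
  rep_dim : nat;
  rep_mx : 'M[{mpoly (complex R)[r * r]}]_rep_dim;
  rep_mx1 : eval_mx rep_mx 1%:M = 1%:M;
  rep_mxM : {in unitmx &, forall g h,
    eval_mx rep_mx (g *m h) = eval_mx rep_mx g *m eval_mx rep_mx h}
}.

Definition rep_act (R : realType) (r : nat) (W : polyrep R r)
    (g : 'M[complex R]_r) : 'M[complex R]_(rep_dim W) :=
  eval_mx (rep_mx W) g.

Lemma eval_std_mx (R : realType) (r : nat) (g : 'M[complex R]_r) :
  eval_mx (\matrix_(i < r, j < r) 'X_(mxvec_index i j)) g = g.
Proof. by apply/matrixP => i j; rewrite !mxE mevalXU mxvecE. Qed.

Lemma std_mx1 (R : realType) (r : nat) :
  eval_mx (\matrix_(i < r, j < r) 'X_(mxvec_index i j)) 1%:M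
  = 1%:M :> 'M[complex R]_r.
Proof. exact: eval_std_mx. Qed.

Lemma std_mxM (R : realType) (r : nat) :
  {in unitmx &, forall g h : 'M[complex R]_r,
    eval_mx (\matrix_(i < r, j < r) 'X_(mxvec_index i j)) (g *m h) =
    eval_mx (\matrix_(i < r, j < r) 'X_(mxvec_index i j)) g *m
    eval_mx (\matrix_(i < r, j < r) 'X_(mxvec_index i j)) h}.
Proof. by move=> g h _ _; rewrite !eval_std_mx. Qed.

Definition std_rep (R : realType) (r : nat) : polyrep R r :=
  PolyRep (@std_mx1 R r) (@std_mxM R r).

Definition is_dsum (R : realType) (r : nat) (W W1 W2 : polyrep R r) : Prop :=
  exists (S : 'M[complex R]_(rep_dim W, rep_dim W1 + rep_dim W2))
         (T : 'M[complex R]_(rep_dim W1 + rep_dim W2, rep_dim W)),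
    [/\ S *m T = 1%:M, T *m S = 1%:M &
        {in unitmx, forall g : 'M[complex R]_r,
          rep_act W g *m S
          = S *m block_mx (rep_act W1 g) 0 0 (rep_act W2 g)}].

(* Rep_Q as a setoid: its elements are presented by formal Q-linear           *)
(* combinations of representations, two of which present the same element     *)
(* when they are related by groth_eq, the Q-linear equivalence generated by   *)
(* [W] = [W1] + [W2] for W isomorphic to the direct sum of W1 and W2          *)
(* (isomorphic representations are identified by taking W2 = 0).              *)
Definition vrep (R : realType) (r : nat) : Type := seq (rat * polyrep R r).

Inductive groth_eq (R : realType) (r : nat) : vrep R r -> vrep R r -> Prop :=
| groth_refl U : groth_eq U U
| groth_sym U U' : groth_eq U U' -> groth_eq U' U
| groth_trans U U' U'' : groth_eq U U' -> groth_eq U' U'' -> groth_eq U U''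
| groth_cat U1 U1' U2 U2' : groth_eq U1 U1' -> groth_eq U2 U2' ->
    groth_eq (U1 ++ U2) (U1' ++ U2')
| groth_catC U1 U2 : groth_eq (U1 ++ U2) (U2 ++ U1)
| groth_0 W : groth_eq [:: (0, W)] [::]
| groth_D a b W : groth_eq [:: (a, W); (b, W)] [:: (a + b, W)]
| groth_dsum a W W1 W2 : is_dsum W W1 W2 ->
    groth_eq [:: (a, W)] [:: (a, W1); (a, W2)].

Definition weight_vector (R : realType) (r : nat) (W : polyrep R r)
    (l : 'X_{1..r}) (w : 'cV[complex R]_(rep_dim W)) : Prop :=
  forall t : 'rV[complex R]_r, (forall i, t 0 i != 0) ->
    rep_act W (diag_mx t) *m w = (\prod_(i < r) t 0 i ^+ l i) *: w.

(* The subspace whose elements are the weight vectors; see weight_spaceP.     *)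
Definition weight_space (R : realType) (r : nat) (W : polyrep R r)
    (l : 'X_{1..r}) : {vspace 'cV[complex R]_(rep_dim W)} :=
  xget 0%VS [set X : {vspace 'cV[complex R]_(rep_dim W)} |
             forall w, w \in X <-> weight_vector l w]%classic.

Lemma weight_spaceP (R : realType) (r : nat) (W : polyrep R r)
    (l : 'X_{1..r}) (w : 'cV[complex R]_(rep_dim W)) :
  w \in weight_space W l <-> weight_vector l w.
Proof.
set vT := 'cV[complex R]_(rep_dim W).
suff : exists X : {vspace vT}, forall w, w \in X <-> weight_vector l w.
  by move=> eX; exact: (xgetPex 0%VS eX).
pose sub (X : {vspace vT}) := forall x, x \in X -> weight_vector l x.
have sub0 : exists m, `[< exists2 X, sub X & \dim X = m >].
  exists 0%N; apply/asboolP; exists 0%VS; last by rewrite dimv0.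
  by move=> x; rewrite memv0 => /eqP -> t _; rewrite mulmx0 scaler0.
have subB m : `[< exists2 X, sub X & \dim X = m >] -> (m <= \dim {:vT})%N.
  by move=> /asboolP[X _ <-]; exact/dimvS/subvf.
have [m /asboolP[X sX dX] max_m] := ex_maxnP sub0 subB.
exists X => x; split=> [|wx]; first exact: sX.
have sX' : sub (X + <[x]>)%VS.
  move=> _ /memv_addP[y yX [_ /vlineP[a ->] ->]] t t0.
  rewrite mulmxDr (sX y yX) // -scalemxAr wx // scalerDr.
  by rewrite !scalerA mulrC.
have le_m : (\dim (X + <[x]>)%VS <= \dim X)%N.
  by rewrite dX; apply: max_m; apply/asboolP; exists (X + <[x]>)%VS.
have -> : X = (X + <[x]>)%VS by apply/eqP; rewrite eqEdim addvSl.
by apply: (subvP (addvSr X _)); exact: memv_line.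
Qed.

(* Only finitely many weight spaces are nonzero, so the finite-support sum is *)
(* the sum over all weights; weights of a polynomial representation have      *)
(* nonnegative entries.                                                       *)
Definition Char_rep (R : realType) (r : nat) (W : polyrep R r) :
    {mpoly rat[r]} :=
  \sum_(l \in [set: 'X_{1..r}]%classic)
    (\dim (weight_space W l))%:R *: ('X_[l] : {mpoly rat[r]}).

Definition Char (R : realType) (r : nat) (U : vrep R r) : {mpoly rat[r]} :=
  \sum_(x <- U) x.1 *: Char_rep x.2.

Definition exp_trunc (r k : nat) (i : 'I_r) : {mpoly rat[r]} :=
  \sum_(j < k.+1) (j`!%:R)^-1 *: 'X_i ^+ j.

(* The terms of e^(a_i) of degree > k do not contribute to the part of degree *)
(* k of Char(U)(e^(a_1), ..., e^(a_r)), so they are dropped.                  *)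
Definition ch (R : realType) (r k : nat) (U : vrep R r) : {mpoly rat[r]} :=
  pihomog mdeg k (Char U \mPo [tuple exp_trunc k i | i < r]).

(* ch_0(U) as a rational number.                                              *)
Definition ch0 (R : realType) (r : nat) (U : vrep R r) : rat :=
  (ch 0 U)@_0%MM.

Definition Delta2 (R : realType) (r : nat) (U : vrep R r) : {mpoly rat[r]} :=
  ch 1 U ^+ 2 - 2%:R * ch 0 U * ch 2 U.

Definition Delta3 (R : realType) (r : nat) (U : vrep R r) : {mpoly rat[r]} :=
  ch 1 U ^+ 3 - 3%:R * ch 0 U * ch 1 U * ch 2 U
    + 3%:R * ch 0 U ^+ 2 * ch 3 U.

(* Only used for k = 2 and k = 3.                                             *)
Definition Delta (R : realType) (r k : nat) (U : vrep R r) : {mpoly rat[r]} :=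
  match k with 2 => Delta2 U | 3 => Delta3 U | _ => 0 end.

(* Only meaningful when ch0 U != 0.                                           *)
Definition dlow (R : realType) (r k : nat) (U : vrep R r) : {mpoly rat[r]} :=
  (k%:R * ch0 U ^+ k.-1)^-1 *: Delta k U.

Definition irreducible_rep (R : realType) (r : nat) (W : polyrep R r) : Prop :=
  (0 < rep_dim W)%N /\
  forall X : {vspace 'cV[complex R]_(rep_dim W)},
    {in unitmx, forall g : 'M[complex R]_r,
      forall x, x \in X -> rep_act W g *m x \in X} ->
    X = 0%VS \/ X = fullv.

Definition upper_unitriangular (R : realType) (r : nat)
    (g : 'M[complex R]_r) : Prop :=
  forall i j : 'I_r, (j <= i)%N -> g i j = (i == j)%:R.

(* Highest weight with respect to the upper triangular Borel subgroup.        *)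
Definition has_highest_weight (R : realType) (r : nat) (W : polyrep R r)
    (l : 'X_{1..r}) : Prop :=
  exists w : 'cV[complex R]_(rep_dim W),
    [/\ w != 0, weight_vector l w &
        forall g, upper_unitriangular g -> rep_act W g *m w = w].

(* Partitions are nonincreasing sequences of positive integers, independently *)
(* of r; a partition with at most r parts is padded with zeros to a weight.   *)
Definition partition_of (d : nat) (al : seq nat) : bool :=
  [&& sorted geq al, 0%N \notin al & sumn al == d].

Definition weight_of (r : nat) (al : seq nat) : 'X_{1..r} :=
  [multinom nth 0%N al i | i < r].

Definition is_schur (R : realType) (r : nat) (al : seq nat)
    (W : polyrep R r) : Prop :=
  irreducible_rep W /\ has_highest_weight W (weight_of r al).

(* For a formal Q-combination u of partitions, U = sum c_al [S^al V] in       *)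
(* Rep_Q, where S^al V = 0 for a partition al with more than r parts.         *)
(* With u running over the combinations of partitions of d, the U so obtained *)
(* are exactly the elements of the span Rep_Q^d of the S^al V, |al| = d.      *)
Definition schur_expansion (R : realType) (r : nat) (u : seq (rat * seq nat))
    (U : vrep R r) : Prop :=
  exists S : seq nat -> polyrep R r,
    (forall x, x \in u -> (size x.2 <= r)%N -> is_schur x.2 (S x.2)) /\
    groth_eq U [seq (x.1, S x.2) | x <- u & (size x.2 <= r)%N].

(* Main.v *)
Require Import Defs.
From HB Require Import structures.
From mathcomp Require Import all_boot all_order all_algebra all_fingroup.
From mathcomp Require Import boolp classical_sets fsbigop reals.
From mathcomp Require Import complex.
From mathcomp.multinomials Require Import mpoly.
From mathcomp Require Import ring zify.

(** The classes d_2 and d_3 are, up to sign and a factor ch_0, the second and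
    third cumulants of the Chern roots, so they ignore the trace part
    p_1(a) / r of the variables.  A product of power sums p_m(e^a), of total
    degree d in the q_i, has Chern character
      e^(d p_1 / r) (P + Q t_2 / 2 + S t_3 / 6 + terms of degree at least 4),
    where t_2 and t_3 are the central forms of the power sums p_2 and p_3.  For
    a single p_m one has P = r, Q = m^2 and S = m^3.  Multiplication takes
    (P, Q, S) and (P', Q', S') to (P P', P Q' + Q P', P S' + S P'), so that, as
    polynomials in r, P has degree at most d while Q and S have degree at most
    d - 1.  The term e^(d p_1 / r) cancels in Delta_2 and Delta_3, and
    d_2(U) = - Q t_2 / 2, d_3(U) = S t_3 / 6.  For V one has Q = S = 1, hence
    the polynomials sought are Q and S, provided that Char(U) is given by one
    formula in the power sums for all r.  This is [uniform_schur_poly] together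
    with [dlow2_rank_form] and [dlow3_rank_form].

    It remains to compute the character of an irreducible polynomial
    representation W of highest weight lam.  It equals the Jacobi-Trudi
    determinant det(h_(lam_i - i + j)), whose size is the number of parts of
    lam, and this determinant is zero as soon as r is smaller than the number of
    parts ([Char_rep_schur], [det_jacobi_trudi_vanish]).  Through alternants,
    this amounts to the Weyl character formula
      Char(W) a_delta = a_(lam + delta),
    whose proof here uses neither integration nor complete reducibility:
    - The torus acts by a matrix of polynomials, whose coefficients are the
      projections onto the weight spaces, and Char(W) is its trace
      ([map_Char_rep]).
    - The Casimir element commutes with GL_r, so it is a scalar on W
      ([casimirE]).  Taking its trace against the torus, and conjugating by
      a_delta, turns this scalar action into an eigenvalue equation for the
      Laplacian sum_i (x_i d/dx_i)^2 on Char(W) a_delta ([laplacian_conj]).  So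
      all the exponents occurring in Char(W) a_delta have the same Euclidean
      norm.
    - As products of lower and upper triangular matrices are dense, the matrix
      coefficients of W are governed by the lower triangular matrices; hence all
      weights of W are dominated by lam, and lam has multiplicity one
      ([left_weight_dominated], [tr_wproj_hw]).
    - An exponent of the antisymmetric polynomial Char(W) a_delta that is
      strictly decreasing, dominated by lam + delta and of the same norm is
      lam + delta ([dominated_same_norm], [weyl_character]). *)

Set Implicit Arguments.
Unset Strict Implicit.
Unset Printing Implicit Defensive.

Import Order.TTheory GRing.Theory Num.Theory.

Local Open Scope ring_scope.

(** * Polynomials on the torus *)

Section Generic.
Variable K : numFieldType.

Lemma poly_eq0_everywhere (p : {poly K}) : (forall s, p.[s] = 0) -> p = 0.
Proof.
move=> p0; apply/eqP; apply: contraT => nz_p.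
pose rs := [seq (i%:R : K) | i <- iota 0 (size p)].
have : (size rs < size p)%N.
  apply: (max_poly_roots nz_p); last first.
    by rewrite map_inj_uniq ?iota_uniq // => i j /eqP; rewrite eqr_nat => /eqP.
  by apply/allP => s _; rewrite rootE p0.
by rewrite size_map size_iota ltnn.
Qed.

Lemma poly_eq0_generic (p q : {poly K}) :
  q != 0 -> (forall s, q.[s] != 0 -> p.[s] = 0) -> p = 0.
Proof.
move=> nz_q pq; apply/eqP; have/eqP : p * q = 0.
  apply: poly_eq0_everywhere => s; rewrite hornerM.
  by have [->|/pq->] := eqVneq q.[s] 0; rewrite ?mulr0 ?mul0r.
by rewrite mulf_eq0 (negbTE nz_q) orbF.
Qed.

Lemma poly_eq_generic (p1 p2 q : {poly K}) :
  q != 0 -> (forall s, q.[s] != 0 -> p1.[s] = p2.[s]) -> p1 = p2.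
Proof.
move=> nz_q pq; apply/subr0_eq/(poly_eq0_generic nz_q) => s /pq pqs.
by rewrite hornerD hornerN pqs subrr.
Qed.

End Generic.

Lemma base_expansion_inj (B n : nat) (l m : 'I_n -> nat) :
    (forall i, (l i < B)%N) -> (forall i, (m i < B)%N) ->
    (\sum_(i < n) l i * B ^ i = \sum_(i < n) m i * B ^ i)%N -> l =1 m.
Proof.
elim: n l m => [|n IHn] l m lB mB; first by move=> _ [].
rewrite !big_ord_recl /= !muln1.
have shift (f : 'I_n.+1 -> nat) : (\sum_(i < n) f (fintype.lift ord0 i) * B ^ bump 0 i
    = B * \sum_(i < n) f (fintype.lift ord0 i) * B ^ i)%N.
  by rewrite big_distrr; apply: eq_bigr => i _; rewrite expnS mulnCA.
rewrite !shift => eq_lm.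
have B0 : (0 < B)%N by exact: leq_ltn_trans (lB ord0).
have e0 : l ord0 = m ord0.
  have := congr1 (modn^~ B) eq_lm.
  by rewrite /= addnC mulnC modnMDl addnC mulnC modnMDl !modn_small.
have /IHn {}IHn : (\sum_(i < n) l (fintype.lift ord0 i) * B ^ i
    = \sum_(i < n) m (fintype.lift ord0 i) * B ^ i)%N.
  apply/eqP; rewrite -(eqn_pmul2l B0); apply/eqP.
  by move: eq_lm; rewrite e0 => /addnI.
move=> i; case: (unliftP ord0 i) => [j|] -> //; exact: IHn.
Qed.

(** Kronecker substitution: for B larger than all the exponents, putting
    v_i = s^(B^i) sends distinct monomials of p to distinct powers of s. *)
Lemma mpoly_eq0_torus (K : numFieldType) n (p : {mpoly K[n]}) :
  (forall v : 'I_n -> K, (forall i, v i != 0) -> p.@[v] = 0) -> p = 0.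
Proof.
move=> p0; pose B := msize p.
pose code (m : 'X_{1..n}) := (\sum_(i < n) m i * B ^ i)%N.
pose q : {poly K} := \sum_(m : 'X_{1..n < B}) p@_m *: 'X^(code m).
have q0 : q = 0.
  apply: (@poly_eq0_generic _ _ 'X); first by rewrite polyX_eq0.
  move=> s; rewrite hornerX => s0.
  have {p0} := p0 (fun i => s ^+ (B ^ i)) (fun i => expf_neq0 _ s0).
  rewrite {1}[p](mpolywE (k := B)) // raddf_sum /= => <-.
  rewrite horner_sum; apply: eq_bigr => m _.
  rewrite hornerZ hornerXn mevalZ mevalX; congr (_ * _).
  rewrite /code; elim/big_ind2: _ => [|x1 y1 x2 y2 <- <-|i _] //.
    by rewrite exprD.
  by rewrite -exprM mulnC.
have smallB (m : 'X_{1..n < B}) i : (m i < B)%N.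
  by apply: leq_ltn_trans (bmdeg m); rewrite mdegE (bigD1 i) //= leq_addr.
apply/mpolyP => m; rewrite mcoeff0.
have [mB|] := ltnP (mdeg m) B;
  last by move=> mB; apply/memN_msupp_eq0/negP => /msize_mdeg_lt; rewrite ltnNge mB.
have := congr1 (fun r : {poly K} => r`_(code m)) q0.
rewrite coef0 coef_sum (bigD1 (BMultinom mB)) //= coefZ coefXn eqxx mulr1.
rewrite big1 ?addr0 // => m' neq_m; rewrite coefZ coefXn.
case: eqP => [code_eq|_]; last by rewrite mulr0.
case/eqP: neq_m; apply/val_inj/mnmP => i /=.
exact: (base_expansion_inj (smallB m') (smallB (BMultinom mB)) (esym code_eq)).
Qed.

Lemma mpoly_eq_torus (K : numFieldType) n (p q : {mpoly K[n]}) :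
  (forall v : 'I_n -> K, (forall i, v i != 0) -> p.@[v] = q.@[v]) -> p = q.
Proof.
move=> pq; apply/subr0_eq/mpoly_eq0_torus => v /pq pqv.
by rewrite mevalB pqv subrr.
Qed.

Section TorusIndependence.
Variables (K : numFieldType) (n a b : nat).

Definition torus_mnm (v : 'I_n -> K) (l : 'X_{1..n}) := \prod_(i < n) v i ^+ l i.

Lemma torus_independent B (c : 'X_{1..n < B} -> 'M[K]_(a, b)) :
    (forall v : 'I_n -> K, (forall i, v i != 0) ->
      \sum_(l : 'X_{1..n < B}) torus_mnm v l *: c l = 0) ->
  forall l, c l = 0.
Proof.
move=> c0 l; apply/matrixP => i j; rewrite mxE.
pose p : {mpoly K[n]} := \sum_(m : 'X_{1..n < B}) c m i j *: 'X_[m].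
have p0 : p = 0.
  apply: mpoly_eq0_torus => v v0; rewrite raddf_sum /=.
  have := congr1 (fun M : 'M_(a, b) => M i j) (c0 v v0).
  rewrite summxE mxE => cv0; rewrite -[RHS]cv0; apply: eq_bigr => m _.
  by rewrite mevalZ mevalX mxE mulrC.
have := congr1 (mcoeff l) p0; rewrite mcoeff0 raddf_sum /= (bigD1 l) //=.
rewrite mcoeffZ mcoeffX eqxx mulr1 big1 ?addr0 // => m neq_m.
by rewrite mcoeffZ mcoeffX -bmeqP (negbTE neq_m) mulr0.
Qed.

End TorusIndependence.

Lemma derivation_prod (A : comNzRingType) (D : A -> A) (I : eqType)
    (s : seq I) (F : I -> A) :
    D 1 = 0 -> (forall x y, D (x * y) = D x * y + x * D y) -> uniq s ->
  D (\prod_(x <- s) F x)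
  = \sum_(x <- s) D (F x) * \prod_(y <- s | y != x) F y.
Proof.
move=> D1 DM; elim: s => [|x s IHs]; first by rewrite !big_nil.
case/andP=> xs us; rewrite big_cons DM IHs // [RHS]big_cons; congr (_ + _).
  rewrite big_cons eqxx /=; congr (_ * _); rewrite big_seq [RHS]big_seq_cond.
  apply: eq_bigl => y; case ys: (y \in s) => //=.
  by symmetry; apply: contraNneq xs => <-; rewrite ys.
rewrite big_distrr; apply: eq_big_seq => y ys /=.
rewrite big_cons; case: eqP => [xy|_]; last by rewrite mulrCA.
by rewrite xy ys in xs.
Qed.

Section Euler.
Variables (n : nat) (R : comNzRingType).
Implicit Types p q : {mpoly R[n]}.

(** The operator x_i d/dx_i: each monomial is an eigenvector, with the
    exponent of x_i as eigenvalue, so that it records weights. *)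
Definition euler (i : 'I_n) p : {mpoly R[n]} := 'X_i * p^`M(i).

Lemma euler_is_linear i : linear (euler i).
Proof. by move=> c p q; rewrite /euler linearP /= mulrDr scalerAr. Qed.
HB.instance Definition _ i := GRing.isLinear.Build R {mpoly R[n]} {mpoly R[n]} _
  (euler i) (euler_is_linear i).

Lemma eulerXm i m : euler i 'X_[m] = (m i)%:R *: 'X_[m].
Proof.
rewrite /euler mderivX -scalerAr -mpolyXD addmC.
have [->|mi0] := eqVneq (m i) 0%N; first by rewrite !scale0r.
by rewrite submK // lep1mP.
Qed.

Lemma mcoeff_euler i p m : (euler i p)@_m = (m i)%:R * p@_m.
Proof.
rewrite {1}[p]mpolyE raddf_sum /= [p in RHS]mpolyE !raddf_sum /= big_distrr /=.
apply: eq_bigr => l _; rewrite linearZ /= eulerXm !mcoeffZ mcoeffX.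
by case: eqP => [->|_]; rewrite ?mulr0 // mulrC !mulr1 mulrC.
Qed.

Lemma eulerM i p q : euler i (p * q) = euler i p * q + p * euler i q.
Proof. by rewrite /euler mderivM mulrDr !mulrA [p * _]mulrC. Qed.

Lemma eulerX i j : euler i 'X_j = (i == j)%:R * 'X_j.
Proof. by rewrite eulerXm mnm1E eq_sym scaler_nat mulr_natl. Qed.

Lemma euler1 i : euler i 1 = 0.
Proof. by rewrite /euler mderivC mulr0. Qed.

End Euler.

Section PartialSums.
Variable r : nat.
Implicit Types l m : 'X_{1..r}.

(** The partial sums that define the dominance order on weights. *)
Definition psum l k := (\sum_(i < r | i < k) l i)%N.

Lemma psumS l (i : 'I_r) : psum l i.+1 = (psum l i + l i)%N.
Proof.
rewrite /psum (bigD1 i) //= addnC; congr (_ + _)%N; apply: eq_bigl => j.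
by rewrite ltnS -(inj_eq val_inj) /=; case: ltngtP.
Qed.

Lemma psum_inj l m : (forall k, psum l k = psum m k) -> l = m.
Proof.
move=> lm; apply/mnmP => i; apply/eqP; rewrite -(eqn_add2l (psum l i)).
by rewrite -psumS lm psumS lm.
Qed.

Lemma psumD l m k : psum (l + m)%MM k = (psum l k + psum m k)%N.
Proof. by rewrite /psum -big_split; apply: eq_bigr => i _; rewrite mnmDE. Qed.

Lemma psum_nth l k : (k <= r)%N -> psum l k = (\sum_(i < k) nth 0 l i)%N.
Proof.
move=> kr; rewrite (big_ord_widen r (fun i => nth 0%N l i)) //.
by apply: eq_bigr => i _; rewrite (mnm_nth 0%N).
Qed.

Lemma psum_full l : psum l r = mdeg l.
Proof. by rewrite mdegE; apply: eq_bigl => i; rewrite ltn_ord. Qed.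

End PartialSums.

(** * Weight spaces and characters *)

(** Through a basis of U, M factors as B D with D B = 1, and the trace is
    cyclic. *)
Lemma dim_fixed_space (F : fieldType) n (M : 'M[F]_n) (U : {vspace 'cV[F]_n}) :
    M *m M = M -> (forall w, w \in U <-> M *m w = w) ->
  \tr M = (\dim U)%:R.
Proof.
move=> MM UM; set b := vbasis U.
pose B := \matrix_(i < n, j < \dim U) b`_j i 0.
pose D := \matrix_(i < \dim U, j < n) coord b i (M *m delta_mx j 0).
have BD : B *m D = M.
  apply/matrixP => i j; rewrite mxE.
  have /UM/coord_vbasis : M *m (M *m delta_mx j 0) = M *m delta_mx j 0 :> 'cV_n.
    by rewrite mulmxA MM.
  move/(congr1 (fun w : 'cV_n => w i 0)); rewrite -colE mxE => ->.
  by rewrite summxE; apply: eq_bigr => k _; rewrite !mxE colE mulrC.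
have DB : D *m B = 1%:M.
  apply/matrixP => i j; rewrite !mxE.
  have bU : b`_j \in U by apply/vbasis_mem/mem_nth; rewrite size_tuple.
  have -> : (i == j)%:R = coord b i (M *m b`_j).
    have /UM -> := bU; rewrite coord_free 1?eq_sym //.
    exact: (basis_free (vbasisP U)).
  have bE : b`_j = \sum_k b`_j k 0 *: delta_mx k 0 :> 'cV_n.
    apply/colP => k; rewrite summxE (bigD1 k) //= big1 => [|k' /negbTE kk'].
      by rewrite !mxE !eqxx mulr1 addr0.
    by rewrite !mxE eq_sym kk' mulr0.
  rewrite [in RHS]bE mulmx_sumr linear_sum; apply: eq_bigr => k _.
  by rewrite !mxE -scalemxAr linearZ /= mulrC.
by rewrite -BD mxtrace_mulC DB mxtrace1.
Qed.

Section Weights.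
Variables (R : realType) (r : nat) (W : polyrep R r).
Local Notation C := (complex R).
Implicit Types v w : 'I_r -> C.

Definition tor (v : 'I_r -> C) : 'M[C]_r := diag_mx (\row_i v i).

Lemma tor_unit v : (forall i, v i != 0) -> tor v \in unitmx.
Proof.
move=> v0; rewrite unitmxE det_diag unitfE; apply/prodf_neq0 => i _.
by rewrite mxE.
Qed.

Lemma torM v w : tor v *m tor w = tor (fun i => v i * w i).
Proof.
by rewrite mulmx_diag; congr diag_mx; apply/rowP => i; rewrite !mxE.
Qed.

Lemma rep_act1 : rep_act W 1%:M = 1%:M.
Proof. exact: rep_mx1. Qed.

Lemma rep_actM g h : g \in unitmx -> h \in unitmx ->
  rep_act W (g *m h) = rep_act W g *m rep_act W h.
Proof. exact: rep_mxM. Qed.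

(** The action of the torus, as a matrix of polynomials in the coordinates of
    the torus; its coefficient of X^l is the projection on the weight space l. *)
Definition torus_mx : 'M[{mpoly C[r]}]_(rep_dim W) :=
  map_mx (comp_mpoly [tuple mxvec (diag_mx (\row_i 'X_i)) 0 l | l < r * r])
    (rep_mx W).

Lemma torus_mxE v : map_mx (meval v) torus_mx = rep_act W (tor v).
Proof.
apply/matrixP => i j; rewrite !mxE comp_mpoly_meval; apply: meval_eq => l.
rewrite tnth_mktuple; case/mxvec_indexP: l => k l; rewrite !mxvecE !mxE.
by rewrite mevalMn mevalXU.
Qed.

Definition wproj (l : 'X_{1..r}) : 'M[C]_(rep_dim W) :=
  map_mx (mcoeff l) torus_mx.

Definition wbound := \max_ij msize (torus_mx ij.1 ij.2).

Lemma wproj_out l : (wbound <= mdeg l)%N -> wproj l = 0.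
Proof.
move=> lB; apply/matrixP => i j; rewrite mxE [RHS]mxE.
apply/memN_msupp_eq0/negP => /msize_mdeg_lt; rewrite ltnNge.
by rewrite (leq_trans _ lB) // (leq_bigmax (i, j)).
Qed.

Lemma rep_torE B v : (wbound <= B)%N ->
  rep_act W (tor v) = \sum_(l : 'X_{1..r < B}) torus_mnm v l *: wproj l.
Proof.
move=> leB; rewrite -torus_mxE; apply/matrixP => i j; rewrite mxE summxE.
rewrite [torus_mx i j](mpolywE (k := B)) ?raddf_sum /=; last first.
  exact: leq_trans (leq_bigmax (i, j)) leB.
by apply: eq_bigr => l _; rewrite mevalZ mevalX !mxE mulrC.
Qed.

Lemma torus_mnmM (v w : 'I_r -> C) l :
  torus_mnm (fun i => v i * w i) l = torus_mnm v l * torus_mnm w l.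
Proof. by rewrite /torus_mnm -big_split; apply: eq_bigr => i _; rewrite exprMn. Qed.

(** Compare the coefficients of w^l in rho(w) rho(v) = rho(w v). *)
Lemma wproj_tor v l : (forall i, v i != 0) ->
  wproj l *m rep_act W (tor v) = torus_mnm v l *: wproj l.
Proof.
move=> v0; have [lB|lB] := ltnP (mdeg l) wbound; last first.
  by rewrite wproj_out // mul0mx scaler0.
apply/subr0_eq.
apply: (torus_independent (c := fun l : 'X_{1..r < wbound} =>
  wproj l *m rep_act W (tor v) - torus_mnm v l *: wproj l) _ (BMultinom lB)).
move=> w w0; under eq_bigr do rewrite scalerBr scalemxAl scalerA -torus_mnmM.
rewrite sumrB -mulmx_suml -!rep_torE // -rep_actM ?torM ?subrr //;
  exact: tor_unit.
Qed.

Lemma tor_wproj v l : (forall i, v i != 0) ->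
  rep_act W (tor v) *m wproj l = torus_mnm v l *: wproj l.
Proof.
move=> v0; have [lB|lB] := ltnP (mdeg l) wbound; last first.
  by rewrite wproj_out // mulmx0 scaler0.
apply/subr0_eq.
apply: (torus_independent (c := fun l : 'X_{1..r < wbound} =>
  rep_act W (tor v) *m wproj l - torus_mnm v l *: wproj l) _ (BMultinom lB)).
move=> w w0.
under eq_bigr do rewrite scalerBr scalemxAr scalerA mulrC -torus_mnmM.
rewrite sumrB -mulmx_sumr -!rep_torE // -rep_actM ?torM ?subrr //;
  exact: tor_unit.
Qed.

(** Expand rho(v) in the projections: distinct monomials in v are linearly
    independent. *)
Lemma tor_eigen m (x : 'M[C]_(rep_dim W, m)) l :
    (forall v, (forall i, v i != 0) -> rep_act W (tor v) *m x = torus_mnm v l *: x) ->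
  wproj l *m x = x /\ forall l', l' != l -> wproj l' *m x = 0.
Proof.
move=> xl.
suff xl' l' : wproj l' *m x = (l' == l)%:R *: x.
  split=> [|l' /negbTE ll']; first by rewrite xl' eqxx scale1r.
  by rewrite xl' ll' scale0r.
pose B := maxn wbound (maxn (mdeg l) (mdeg l')).+1.
have lB : (mdeg l < B)%N by rewrite /B leq_max ltnS leq_maxl orbT.
have lB' : (mdeg l' < B)%N by rewrite /B leq_max ltnS leq_maxr orbT.
apply/subr0_eq.
apply: (torus_independent (c := fun l' : 'X_{1..r < B} =>
  wproj l' *m x - (bmnm l' == l)%:R *: x) _ (BMultinom lB')).
move=> w w0; under eq_bigr do rewrite scalerBr scalemxAl scalerA.
rewrite sumrB -mulmx_suml -rep_torE ?leq_maxl // xl //.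
rewrite (bigD1 (BMultinom lB)) //= eqxx mulr1 big1 ?addr0 ?subrr // => m'.
by rewrite -val_eqE /= => /negbTE ->; rewrite mulr0 scale0r.
Qed.

Lemma wprojM l l' : wproj l *m wproj l' = (l == l')%:R *: wproj l'.
Proof.
have [|e0 e1] := @tor_eigen _ (wproj l') l'; first by move=> v; exact: tor_wproj.
by case: eqP => [->|/eqP/e1->]; rewrite ?scale1r ?e0 ?scale0r.
Qed.

Lemma wproj_sum : \sum_(l : 'X_{1..r < wbound}) wproj l = 1%:M.
Proof.
rewrite -rep_act1; have -> : 1%:M = tor (fun=> 1).
  by apply/matrixP => i j; rewrite !mxE.
rewrite (rep_torE _ (leqnn _)); apply: eq_bigr => l _.
by rewrite /torus_mnm big1 ?scale1r // => i _; rewrite expr1n.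
Qed.

Lemma weight_vectorP l (w : 'cV_(rep_dim W)) :
  weight_vector l w <-> wproj l *m w = w.
Proof.
have torE (t : 'rV[C]_r) : diag_mx t = tor (t 0).
  by congr diag_mx; apply/rowP => i; rewrite mxE.
split=> [lw|lw t t0].
  apply: (tor_eigen (l := l) _).1 => v v0.
  rewrite lw => [|i]; last by rewrite mxE.
  by congr (_ *: _); apply: eq_bigr => i _; rewrite mxE.
by rewrite -lw mulmxA torE tor_wproj // -scalemxAl.
Qed.

(** The trace of an idempotent is the dimension of its image. *)
Lemma tr_wproj l : \tr (wproj l) = (\dim (weight_space W l))%:R.
Proof.
apply: dim_fixed_space => [|w]; first by rewrite wprojM eqxx scale1r.
by split=> [/weight_spaceP/weight_vectorP|/weight_vectorP/weight_spaceP].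
Qed.

(** The character with complex coefficients, as the trace of the torus action.
    In this form it is plainly invariant under change of basis. *)
Definition torus_char : {mpoly C[r]} := \tr torus_mx.

Lemma mcoeff_torus_char l : torus_char@_l = \tr (wproj l).
Proof.
rewrite /torus_char /mxtrace raddf_sum.
by apply: eq_bigr => i _; rewrite [RHS]mxE.
Qed.

Lemma meval_torus_char v : torus_char.@[v] = \tr (rep_act W (tor v)).
Proof.
rewrite -torus_mxE /torus_char /mxtrace raddf_sum.
by apply: eq_bigr => i _; rewrite [RHS]mxE.
Qed.

Lemma mcoeff_Char_rep l : (Char_rep W)@_l = (\dim (weight_space W l))%:R.
Proof.
have sub0 m : (wbound <= mdeg m)%N -> \dim (weight_space W m) = 0%N.
  move=> /wproj_out mB; apply/eqP; rewrite -(eqr_nat C) -tr_wproj mB.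
  by rewrite mxtrace0.
pose s := [seq bmnm m | m : 'X_{1..r < wbound}].
have us : uniq s by rewrite map_inj_uniq ?enum_uniq //; exact: val_inj.
rewrite /Char_rep (fsbigE s) //; last first.
  move=> m _; case: (ltnP (mdeg m) wbound) => [mB|/sub0 ->]; last first.
    by rewrite scale0r.
  by case/negP; apply/mapP; exists (BMultinom mB); rewrite ?mem_enum.
rewrite (eq_bigl xpredT) => [|m]; last exact: in_setT.
rewrite raddf_sum /=; under eq_bigr do rewrite mcoeffZ mcoeffX.
have [lB|lB] := ltnP (mdeg l) wbound; last first.
  rewrite sub0 // big1_seq // => m /andP[_ /mapP[m' _ ->]].
  case: eqP => [ml|]; last by rewrite mulr0.
  by move: (bmdeg m'); rewrite ml ltnNge lB.
rewrite (bigD1_seq l) /=; first last.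
- exact: us.
- by apply/mapP; exists (BMultinom lB); rewrite ?mem_enum.
rewrite eqxx mulr1 big1 ?addr0 // => m /negbTE ->; exact: mulr0.
Qed.

Lemma map_Char_rep : map_mpoly ratr (Char_rep W) = torus_char.
Proof.
apply/mpolyP => l; rewrite mcoeff_map_mpoly mcoeff_Char_rep mcoeff_torus_char.
rewrite tr_wproj; exact: ratr_nat.
Qed.

End Weights.

Lemma map_ratr_inj (F : numFieldType) n :
  injective (map_mpoly (ratr : rat -> F) : {mpoly rat[n]} -> {mpoly F[n]}).
Proof.
move=> p q pq; apply/mpolyP => m; apply: (fmorph_inj (@ratr F)).
by rewrite -!mcoeff_map_mpoly pq.
Qed.

Section Groth.
Variables (R : realType) (r : nat).
Local Notation C := (complex R).

Lemma Char_rep_dsum (W W1 W2 : polyrep R r) :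
  is_dsum W W1 W2 -> Char_rep W = Char_rep W1 + Char_rep W2.
Proof.
move=> [S [T [ST TS WS]]]; apply: (@map_ratr_inj C); rewrite rmorphD /=.
rewrite !map_Char_rep; apply: mpoly_eq_torus => v v0; rewrite mevalD.
rewrite !meval_torus_char -(mxtrace_block _ 0 0) -[in LHS](mulmx1 (rep_act W _)) -ST.
by rewrite mulmxA WS ?tor_unit // -mulmxA mxtrace_mulC -mulmxA TS mulmx1.
Qed.

Lemma Char_nil : Char ([::] : vrep R r) = 0.
Proof. exact: big_nil. Qed.

Lemma Char_cons a W (U : vrep R r) :
  Char ((a, W) :: U) = a *: Char_rep W + Char U.
Proof. exact: big_cons. Qed.

Lemma Char_cat (U1 U2 : vrep R r) : Char (U1 ++ U2) = Char U1 + Char U2.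
Proof. exact: big_cat. Qed.

(** The trace of the torus action is additive on direct sums, so Char is well
    defined on Rep_Q. *)
Lemma Char_groth (U U' : vrep R r) : groth_eq U U' -> Char U = Char U'.
Proof.
elim=> {U U'} //.
- by move=> U1 U2 U3 _ -> _ ->.
- by move=> U1 U1' U2 U2' _ e1 _ e2; rewrite !Char_cat e1 e2.
- by move=> U1 U2; rewrite !Char_cat addrC.
- by move=> W; rewrite Char_cons Char_nil scale0r addr0.
- by move=> a b W; rewrite !Char_cons Char_nil !addr0 scalerDl.
- move=> a W W1 W2 /Char_rep_dsum WE.
  by rewrite !Char_cons Char_nil !addr0 WE scalerDr.
Qed.

Lemma Char_std_rep : Char_rep (std_rep R r) = \sum_i 'X_i.
Proof.
apply: (@map_ratr_inj C); rewrite map_Char_rep rmorph_sum /=.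
apply: mpoly_eq_torus => v v0; rewrite meval_torus_char raddf_sum /= /rep_act.
rewrite eval_std_mx mxtrace_diag; apply: eq_bigr => i _.
by rewrite map_mpolyX mevalXU mxE.
Qed.

End Groth.

(** * Differentiated representations and the Casimir element *)

(** The inverse of 1 + s e is 1 - s e, so conjugation by 1 + s e is polynomial
    in s. *)
Lemma conj_nilpotent (K : comNzRingType) n (e X : 'M[K]_n) s : e *m e = 0 ->
  (1%:M + s *: e) *m X
  = (X + s *: (e *m X - X *m e) - s ^+ 2 *: (e *m X *m e)) *m (1%:M + s *: e).
Proof.
move=> ee; rewrite mulmxDl mul1mx mulmxDr mulmx1 -scalemxAr -scalemxAl.
rewrite !mulmxBl mulmxDl -!scalemxAl mulmxBl -!mulmxA ee !mulmx0 subr0 scaler0.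
rewrite subr0; move: (e *m X) (X *m e) (e *m _) => A B D.
by apply/matrixP => i j; rewrite !mxE; ring.
Qed.

Section Curves.
Variables (K : comNzRingType) (N : nat) (h : 'I_N -> {poly K}).

Lemma horner_mmap (p : {mpoly K[N]}) s :
  (mmap polyC h p).[s] = p.@[fun l => (h l).[s]].
Proof.
rewrite /meval /mmap horner_sum; apply: eq_bigr => m _.
rewrite hornerM hornerC /mmap1 horner_prod; congr (_ * _).
by apply: eq_bigr => i _; rewrite horner_exp.
Qed.

(** The chain rule along a polynomial curve h. *)
Lemma deriv_mmap (p : {mpoly K[N]}) :
  (mmap polyC h p)^`() = \sum_l (h l)^`() * mmap polyC h p^`M(l).
Proof.
pose S (q : {mpoly K[N]}) :=
  (mmap polyC h q)^`() = \sum_l (h l)^`() * mmap polyC h q^`M(l).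
have SD q1 q2 : S q1 -> S q2 -> S (q1 + q2).
  rewrite /S => e1 e2; rewrite mmapD derivD e1 e2 -big_split /=.
  by apply: eq_bigr => l _; rewrite mderivD mmapD mulrDr.
have SM q1 q2 : S q1 -> S q2 -> S (q1 * q2).
  rewrite /S => e1 e2; rewrite rmorphM /= derivM e1 e2.
  rewrite big_distrl big_distrr -big_split /=.
  apply: eq_bigr => l _; rewrite mderivM mmapD !rmorphM mulrDr -mulrA.
  by rewrite [X in _ + X = _]mulrCA.
have SC c : S c%:MP.
  rewrite /S mmapC derivC big1 // => l _.
  by rewrite mderivC mmap0 mulr0.
have SX i : S 'X_i.
  rewrite /S mmapX mmap1U (bigD1 i) //= big1 => [|l li]; last first.
    by rewrite mderivX mnm1E eq_sym (negbTE li) scale0r mmap0 mulr0.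
  rewrite mderivX mnm1E eqxx scale1r addr0.
  have -> : (U_(i) - U_(i))%MM = 0%MM :> 'X_{1..N}.
    by apply/mnmP => j; rewrite mnmBE subnn mnm0E.
  by rewrite mpolyX0 rmorph1 mulr1.
rewrite [p]mpolyE; apply: (big_ind S) => [||m _]; first exact: SC 0.
  exact: (SD).
rewrite -mul_mpolyC; apply: (SM) => //; rewrite mpolyXE_id.
apply: (big_ind S) => [||i _]; [exact: SC 1 | exact: (SM) |].
by elim: (m i) => [|k IHk]; [exact: SC 1 | rewrite exprS; exact: (SM)].
Qed.

Lemma coef1_mmap (p : {mpoly K[N]}) : (mmap polyC h p)`_1
  = \sum_l (h l)`_1 * (p^`M(l)).@[fun l => (h l)`_0].
Proof.
have c1 (q : {poly K}) : q`_1 = q^`().[0].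
  by rewrite horner_coef0 coef_deriv mulr1n.
rewrite c1 deriv_mmap horner_sum; apply: eq_bigr => l _.
rewrite hornerM -c1 horner_mmap; congr (_ * _); apply: meval_eq => k.
by rewrite horner_coef0.
Qed.

End Curves.

Section CoefMx.
Variable K : comNzRingType.

Definition cmx k m n (A : 'M[{poly K}]_(m, n)) : 'M[K]_(m, n) :=
  map_mx (coefp k) A.

Lemma cmx1M m n p (A : 'M[{poly K}]_(m, n)) (B : 'M_(n, p)) :
  cmx 1 (A *m B) = cmx 0 A *m cmx 1 B + cmx 1 A *m cmx 0 B.
Proof.
apply/matrixP => i j; rewrite !mxE /coefp coef_sum -big_split.
apply: eq_bigr => k _ /=.
by rewrite !mxE /coefp coefM !big_ord_recl big_ord0 addr0.
Qed.

Lemma cmxD k m n (A B : 'M[{poly K}]_(m, n)) : cmx k (A + B) = cmx k A + cmx k B.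
Proof. by rewrite /cmx map_mxD. Qed.

Lemma cmxB k m n (A B : 'M[{poly K}]_(m, n)) : cmx k (A - B) = cmx k A - cmx k B.
Proof. by rewrite /cmx map_mxB. Qed.

Lemma cmxC k m n (A : 'M[K]_(m, n)) : cmx k (map_mx polyC A) = (k == 0%N)%:R *: A.
Proof.
apply/matrixP => i j; rewrite !mxE /coefp coefC.
by case: eqP; rewrite ?mul1r ?mul0r.
Qed.

Lemma cmxXn k e m n (A : 'M[K]_(m, n)) :
  cmx k ('X^e *: map_mx polyC A) = (k == e)%:R *: A.
Proof. by apply/matrixP => i j; rewrite !mxE /coefp coefMC coefXn. Qed.

Definition hmx s m n (A : 'M[{poly K}]_(m, n)) : 'M[K]_(m, n) :=
  map_mx (horner_eval s) A.

Lemma hmxC s m n (A : 'M[K]_(m, n)) : hmx s (map_mx polyC A) = A.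
Proof. by apply/matrixP => i j; rewrite !mxE /horner_eval hornerC. Qed.

Lemma hmxM s m n p (A : 'M[{poly K}]_(m, n)) (B : 'M_(n, p)) :
  hmx s (A *m B) = hmx s A *m hmx s B.
Proof. exact: map_mxM. Qed.

Lemma hmx0 m n (A : 'M[{poly K}]_(m, n)) : hmx 0 A = cmx 0 A.
Proof. by apply/matrixP => i j; rewrite !mxE /horner_eval horner_coef0. Qed.

End CoefMx.

(** Identities between polynomial curves may be checked at generic values of
    the parameter, where the matrices involved are invertible. *)
Lemma polymx_eq_generic (K : numFieldType) m n (A B : 'M[{poly K}]_(m, n)) q :
  q != 0 -> (forall s, q.[s] != 0 -> hmx s A = hmx s B) -> A = B.
Proof.
move=> q0 AB; apply/matrixP => i j; apply: (poly_eq_generic q0) => s /AB.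
by move/(congr1 (fun M : 'M__ => M i j)); rewrite !mxE.
Qed.

Section Lie.
Variables (R : realType) (r : nat) (W : polyrep R r).
Local Notation C := (complex R).
Implicit Types (G H : 'M[{poly C}]_r) (X Y : 'M[C]_r) (v : 'I_r -> C).

(** The image under W of a polynomial curve of r x r matrices. *)
Definition rep_curve G : 'M[{poly C}]_(rep_dim W) :=
  map_mx (mmap polyC (fun l => mxvec G 0 l)) (rep_mx W).

Lemma hmx_rep_curve s G : hmx s (rep_curve G) = rep_act W (hmx s G).
Proof.
apply/matrixP => i j; rewrite !mxE /horner_eval horner_mmap.
apply: meval_eq => l; case/mxvec_indexP: l => k l.
by rewrite !mxvecE mxE.
Qed.

Lemma cmx0_rep_curve G : cmx 0 (rep_curve G) = rep_act W (cmx 0 G).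
Proof. by rewrite -!hmx0 hmx_rep_curve. Qed.

Lemma rep_curveC g : rep_curve (map_mx polyC g) = map_mx polyC (rep_act W g).
Proof.
apply: (polymx_eq_generic (oner_neq0 _)) => s _.
by rewrite hmx_rep_curve !hmxC.
Qed.

Lemma hmx_unit s G : (\det G).[s] != 0 -> hmx s G \in unitmx.
Proof. by rewrite unitmxE unitfE /hmx det_map_mx. Qed.

Lemma rep_curveM G H : \det G != 0 -> \det H != 0 ->
  rep_curve (G *m H) = rep_curve G *m rep_curve H.
Proof.
move=> G0 H0; apply: (polymx_eq_generic (mulf_neq0 G0 H0)) => s.
rewrite hornerM mulf_eq0 negb_or => /andP[Gs Hs].
by rewrite hmxM !hmx_rep_curve hmxM rep_actM ?hmx_unit.
Qed.

(** The differential of W at the identity matrix. *)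
Definition lie_act X : 'M[C]_(rep_dim W) :=
  \sum_l mxvec X 0 l *:
    map_mx (fun p => (p^`M(l)).@[fun k => mxvec (1%:M : 'M[C]_r) 0 k]) (rep_mx W).

Lemma lie_act_is_linear : linear lie_act.
Proof.
move=> a X Y; rewrite /lie_act scaler_sumr -big_split; apply: eq_bigr => l _ /=.
by rewrite linearP !mxE scalerDl scalerA.
Qed.
HB.instance Definition _ :=
  GRing.isLinear.Build C 'M[C]_r 'M[C]_(rep_dim W) _ lie_act lie_act_is_linear.

Lemma cmx1_rep_curve G : cmx 0 G = 1%:M -> cmx 1 (rep_curve G) = lie_act (cmx 1 G).
Proof.
move=> G1; apply/matrixP => i j; rewrite !mxE /coefp coef1_mmap summxE.
apply: eq_bigr => l _; rewrite !mxE.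
have cG k : forall m : 'I_(r * r), (mxvec G 0 m)`_k = mxvec (cmx k G) 0 m.
  by move=> m; case/mxvec_indexP: m => a b; rewrite !mxvecE mxE.
by rewrite cG; congr (_ * _); apply: meval_eq => m; rewrite cG G1.
Qed.

Definition line X : 'M[{poly C}]_r := 1%:M + 'X *: map_mx polyC X.

Lemma hmx_line s X : hmx s (line X) = 1%:M + s *: X.
Proof.
apply/matrixP => i j.
by rewrite !mxE /horner_eval hornerD hornerM hornerX hornerC hornerMn hornerC.
Qed.

Lemma cmx0_line X : cmx 0 (line X) = 1%:M.
Proof. by rewrite -hmx0 hmx_line scale0r addr0. Qed.

Lemma cmx1_line X : cmx 1 (line X) = X.
Proof.
apply/matrixP => i j; rewrite !mxE /coefp coefD coefXM coefC /=.
by rewrite coefMn coefC /= mul0rn add0r.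
Qed.

Lemma det_line X : \det (line X) != 0.
Proof.
apply/eqP => /(congr1 (horner_eval 0)); rewrite -det_map_mx -/(hmx 0 _).
rewrite hmx_line scale0r addr0 det1 /horner_eval horner0.
by move/eqP; rewrite oner_eq0.
Qed.

(** Take the coefficient of s in rho(g (1 + s X)) = rho((1 + s Y) g). *)
Lemma lie_act_adjoint g X Y : g \in unitmx -> g *m X = Y *m g ->
  rep_act W g *m lie_act X = lie_act Y *m rep_act W g.
Proof.
move=> ug gXY.
have : rep_curve (map_mx polyC g *m line X) = rep_curve (line Y *m map_mx polyC g).
  congr rep_curve; rewrite /line mulmxDr mulmxDl mulmx1 mul1mx; congr (_ + _).
  by rewrite -scalemxAr -scalemxAl -!map_mxM gXY.
have dg : \det (map_mx polyC g) != 0.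
  by rewrite det_map_mx polyC_eq0 -unitfE -unitmxE.
rewrite !rep_curveM ?det_line // rep_curveC => /(congr1 (@cmx _ 1 _ _)).
rewrite !cmx1M !cmxC !cmx1_rep_curve ?cmx0_line // !cmx1_line !scale1r !scale0r.
by rewrite mul0mx mulmx0 addr0 add0r.
Qed.

Local Notation E i j := (delta_mx i j : 'M[C]_r).
Definition lie_unit i j := lie_act (E i j).

(** The matrix e = E_ij has square zero, so the conjugate of X by 1 + s e is a
    polynomial curve, and the bracket is the coefficient of s in the adjoint
    action of 1 + s e. *)
Lemma lie_act_comm i j X : i != j ->
  lie_unit i j *m lie_act X - lie_act X *m lie_unit i j
  = lie_act (E i j *m X - X *m E i j).
Proof.
move=> ij; set e := E i j.
have ee : e *m e = 0 by rewrite mul_delta_mx_0 // eq_sym.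
pose Z : 'M[{poly C}]_(rep_dim W) := map_mx polyC (lie_act X)
  + 'X^1 *: map_mx polyC (lie_act (e *m X - X *m e))
  - 'X^2 *: map_mx polyC (lie_act (e *m X *m e)).
have : rep_curve (line e) *m map_mx polyC (lie_act X) = Z *m rep_curve (line e).
  apply: (polymx_eq_generic (det_line e)) => s /hmx_unit us.
  rewrite !hmxM hmx_rep_curve hmxC.
  have -> : hmx s Z = lie_act (X + s *: (e *m X - X *m e) - s ^+ 2 *: (e *m X *m e)).
    rewrite [in RHS]linearB [in RHS]linearD /= [lie_act (s *: _)]linearZ.
    rewrite [lie_act (s ^+ 2 *: _)]linearZ /=.
    apply/matrixP => a b; rewrite !mxE /horner_eval.
    by rewrite !(hornerE, hornerXn).
  by apply: lie_act_adjoint => //; rewrite hmx_line; exact: conj_nilpotent.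
move/(congr1 (@cmx _ 1 _ _)); rewrite !cmx1M cmx0_rep_curve cmx1_rep_curve ?cmx0_line //.
rewrite cmx1_line /Z !cmxB !cmxD !cmxC !cmxXn !scale1r !scale0r !subr0 addr0 add0r.
by rewrite rep_act1 mulmx0 add0r mulmx1 /lie_unit -/e => ->; rewrite addrAC subrr add0r.
Qed.

Lemma lie_unit_comm i j : i != j ->
  lie_unit i j *m lie_unit j i - lie_unit j i *m lie_unit i j
  = lie_unit i i - lie_unit j j.
Proof.
by move=> ij; rewrite lie_act_comm // !mul_delta_mx linearB.
Qed.

Lemma tor_lie_unit v i j : (forall k, v k != 0) ->
  rep_act W (tor v) *m lie_unit i j = (v i / v j) *: lie_unit i j *m rep_act W (tor v).
Proof.
move=> v0; rewrite -linearZ; apply: lie_act_adjoint; first exact: tor_unit.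
apply/matrixP => a b; rewrite -scalemxAl mul_diag_mx mul_mx_diag !mxE.
case: (a =P i) => [->|_]; case: (b =P j) => [->|_] /=;
  rewrite ?mulr0 ?mul0r ?mulr0 ?mul0r //.
by rewrite mulr1 mul1r mulfVK.
Qed.

(** The differential of the torus: take the coefficient of s in the action of
    the diagonal matrix with 1 + s in place i. *)
Lemma wproj_lie_unit l i : wproj W l *m lie_unit i i = (l i)%:R *: wproj W l.
Proof.
pose c : 'M[{poly C}]_(rep_dim W) := map_mx polyC (wproj W l).
have : c *m rep_curve (line (E i i)) = ('X + 1) ^+ l i *: c.
  apply: (polymx_eq_generic (det_line (E i i))) => s.
  move/hmx_unit; rewrite hmxM hmx_rep_curve !hmxC hmx_line => us.
  have sE : 1%:M + s *: E i i = tor (fun k => if k == i then s + 1 else 1).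
    apply/matrixP => a b; rewrite !mxE.
    have [<-|ab] := eqVneq a b; rewrite /= ?andbb.
      by case: eqP => _; rewrite ?mulr1 ?mulr0 ?addr0 // addrC.
    have -> : (a == i) && (b == i) = false.
      by apply: contraNF ab => /andP[/eqP-> /eqP->].
    by rewrite mulr0 addr0.
  have s1 : s + 1 != 0.
    apply/eqP => s1; move: us; rewrite sE s1 unitmxE det_diag (bigD1 i) //=.
    by rewrite mxE eqxx mul0r unitr0.
  rewrite sE wproj_tor => [|k]; last by case: (k == i); rewrite ?oner_eq0.
  have -> : torus_mnm (fun k => if k == i then s + 1 else 1) l = (s + 1) ^+ l i.
    rewrite /torus_mnm (bigD1 i) //= eqxx big1 ?mulr1 // => k /negbTE ->.
    by rewrite expr1n.
  apply/matrixP => a b; rewrite !mxE /horner_eval.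
  by rewrite !(hornerE, horner_exp).
move/(congr1 (@cmx _ 1 _ _)); rewrite !cmx1M cmx1_rep_curve ?cmx0_line //.
rewrite !cmxC cmx1_line scale0r mul0mx addr0 scale1r => ->.
apply/matrixP => a b; rewrite !mxE /coefp coefMC; congr (_ * _).
have c1 (q : {poly C}) : q`_1 = q^`().[0].
  by rewrite horner_coef0 coef_deriv mulr1n.
by rewrite c1 deriv_exp derivD derivX derivC addr0 mul1r hornerMn horner_exp
  !hornerE expr1n.
Qed.

Lemma lie_unit_wproj l i : lie_unit i i *m wproj W l = (l i)%:R *: wproj W l.
Proof.
rewrite -[lie_unit i i]mul1mx -(wproj_sum W) mulmx_suml mulmx_suml.
under eq_bigr do rewrite wproj_lie_unit -scalemxAl wprojM.
have [lB|lB] := ltnP (mdeg l) (wbound W); last first.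
  by rewrite wproj_out // big1 ?scaler0 // => m _; rewrite !scaler0.
rewrite (bigD1 (BMultinom lB)) //= eqxx scale1r big1 ?addr0 // => m.
by rewrite -val_eqE /= => /negbTE ->; rewrite scale0r scaler0.
Qed.

(** The quadratic Casimir element of gl_r. *)
Definition casimir := \sum_i \sum_j lie_unit i j *m lie_unit j i.

(** The tensor sum_ij E_ij (x) E_ji is invariant under GL_r; this is the half
    of that statement where g moves from one factor to the other. *)
Lemma delta_sum_swap n (f : 'M[C]_r -> 'M[C]_r -> 'M[C]_n) (g : 'M[C]_r) :
    (forall Y, linear (f^~ Y)) -> (forall X, linear (f X)) ->
  \sum_i \sum_j f (g *m E i j) (E j i) = \sum_i \sum_j f (E i j) (E j i *m g).
Proof.
move=> fl fr.
have lsum (h : 'M[C]_r -> 'M[C]_n) c (X : 'I_r -> 'M[C]_r) : linear h ->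
    h (\sum_k c k *: X k) = \sum_k c k *: h (X k).
  move=> hl; have h0 : h 0 = 0.
    by have := hl (-1) 0 0; rewrite !scaleN1r oppr0 addr0 => ->; rewrite addNr.
  by elim/big_rec2: _ => // k x y _ <-; rewrite hl.
have gE i j : g *m E i j = \sum_k g k i *: E k j.
  apply/matrixP => x y; transitivity (g x i * (y == j)%:R).
    rewrite mxE (bigD1 i) //= !mxE eqxx big1 ?addr0 // => k /negbTE ki.
    by rewrite mxE ki mulr0.
  rewrite summxE (bigD1 x) //= !mxE eqxx big1 ?addr0 // => k kx.
  by rewrite !mxE eq_sym (negbTE kx) mulr0.
have Eg i j : E j i *m g = \sum_k g i k *: E j k.
  apply/matrixP => x y; transitivity (g i y * (x == j)%:R).
    rewrite mxE (bigD1 i) //= !mxE eqxx andbT big1 ?addr0 1?mulrC // => k ki.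
    by rewrite mxE (negbTE ki) andbF mul0r.
  rewrite summxE (bigD1 y) //= !mxE eqxx andbT big1 ?addr0 // => k kx.
  by rewrite !mxE [y == k]eq_sym (negbTE kx) andbF mulr0.
rewrite exchange_big [RHS]exchange_big /=; apply: eq_bigr => j _.
under eq_bigr do rewrite gE (lsum (f^~ _)) //.
under [RHS]eq_bigr do rewrite Eg lsum //.
exact: exchange_big.
Qed.

Lemma casimir_central g : g \in unitmx ->
  rep_act W g *m casimir = casimir *m rep_act W g.
Proof.
move=> ug; pose h := invmx g.
have gE (X : 'M[C]_r) : rep_act W g *m lie_act X = lie_act (g *m X *m h) *m rep_act W g.
  by apply: lie_act_adjoint => //; rewrite /h mulmxKV.
rewrite mulmx_suml mulmx_sumr.
transitivity ((\sum_i \sum_j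
    lie_act (g *m E i j *m h) *m lie_act (g *m E j i *m h)) *m rep_act W g).
  rewrite mulmx_suml; apply: eq_bigr => i _; rewrite mulmx_suml mulmx_sumr.
  by apply: eq_bigr => j _; rewrite /= mulmxA gE -mulmxA gE mulmxA.
rewrite -mulmx_suml; congr (_ *m _).
rewrite (@delta_sum_swap _
  (fun X Y => lie_act (X *m h) *m lie_act (g *m Y *m h))); first last.
- move=> X c Y Z; rewrite mulmxDr mulmxDl linearD mulmxDr.
  by rewrite -!(scalemxAr, scalemxAl) linearZ -scalemxAr.
- by move=> Y c X Z; rewrite mulmxDl linearD mulmxDl -scalemxAl linearZ -scalemxAl.
rewrite exchange_big /=.
transitivity (\sum_i \sum_j lie_act (E j i *m h) *m lie_act (g *m E i j)).
  apply: eq_bigr => i _; apply: eq_bigr => j _.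
  by rewrite mulmxA mulmxK.
rewrite (@delta_sum_swap _ (fun X Y => lie_act (Y *m h) *m lie_act X)); first last.
- by move=> X c Y Z; rewrite mulmxDl linearD mulmxDl -scalemxAl linearZ -scalemxAl.
- by move=> Y c X Z; rewrite linearD mulmxDr linearZ -scalemxAr.
rewrite exchange_big /=; apply: eq_bigr => i _; apply: eq_bigr => j _.
by rewrite mulmxK.
Qed.

End Lie.

(** * Highest weight vectors *)

(** A subspace of maximal dimension among those contained in S is all of S. *)
Lemma vspace_of_closed (K : fieldType) (vT : vectType K) (S : vT -> Prop) :
    S 0 -> (forall a x y, S x -> S y -> S (a *: x + y)) ->
  exists X : {vspace vT}, forall x, x \in X <-> S x.
Proof.
move=> S0 Slin; pose sub (X : {vspace vT}) := forall x, x \in X -> S x.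
have sub0 : exists m, `[< exists2 X, sub X & \dim X = m >].
  exists 0%N; apply/asboolP; exists 0%VS; last by rewrite dimv0.
  by move=> x; rewrite memv0 => /eqP ->.
have subB m : `[< exists2 X, sub X & \dim X = m >] -> (m <= \dim {:vT})%N.
  by move=> /asboolP[X _ <-]; exact/dimvS/subvf.
have [m /asboolP[X sX dX] max_m] := ex_maxnP sub0 subB.
exists X => x; split=> [|Sx]; first exact: sX.
have le_m : (\dim (X + <[x]>)%VS <= \dim X)%N.
  rewrite dX; apply: max_m; apply/asboolP; exists (X + <[x]>)%VS => // z.
  move=> /memv_addP[y yX [_ /vlineP[a ->] ->]]; rewrite addrC.
  by apply: Slin => //; exact: sX.
have -> : X = (X + <[x]>)%VS by apply/eqP; rewrite eqEdim addvSl.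
by apply: (subvP (addvSr X _)); exact: memv_line.
Qed.

Section Triangular.
Variable K : numFieldType.

Definition lower_triangular r (b : 'M[K]_r) := forall i j : 'I_r, (i < j)%N -> b i j = 0.

Lemma det_shift_neq0 r (g : 'M[K]_r) : \det ('X%:M + map_mx polyC g) != 0.
Proof.
have := monic_neq0 (char_poly_monic (- g)).
by rewrite /char_poly /char_poly_mx map_mxN opprK.
Qed.

Lemma hmx_shift r (g : 'M[K]_r) s : hmx s ('X%:M + map_mx polyC g) = s%:M + g.
Proof.
apply/matrixP => i j; rewrite !mxE /horner_eval hornerD hornerMn.
by rewrite hornerX hornerC.
Qed.

(** For all but finitely many s, the leading minors of s + g are nonzero, so
    that Gaussian elimination on columns needs no pivoting. The induction
    removes the last row and column, and only asks that the remaining leading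
    block be invertible. *)
Lemma generic_lower_upper r (g : 'M[K]_r) :
  exists2 q : {poly K}, q != 0 & forall s, q.[s] != 0 ->
  exists u : 'M[K]_r, (forall i j : 'I_r, (j <= i)%N -> u i j = (i == j)%:R)
    /\ lower_triangular ((s%:M + g) *m u).
Proof.
elim: r => [|r IHr] in g *.
  exists 1; first exact: oner_neq0.
  by move=> s _; exists 1%:M; split=> [[]|[]].
move: g; rewrite -[r.+1]addn1 => g.
have [q q0 qP] := IHr (ulsubmx g).
exists (q * \det ('X%:M + map_mx polyC (ulsubmx g))).
  by rewrite mulf_neq0 // det_shift_neq0.
move=> s; rewrite hornerM mulf_eq0 negb_or => /andP[/qP[u [uu lu]]].
have hu t (G : 'M[{poly K}]_r) : (\det G).[t] != 0 -> hmx t G \in unitmx.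
  by rewrite unitmxE unitfE /hmx det_map_mx.
move/hu; rewrite hmx_shift; set A := s%:M + ulsubmx g in lu * => uA.
have gE : s%:M + g = block_mx A (ursubmx g) (dlsubmx g) (s%:M + drsubmx g).
  by rewrite -{1}[g]submxK scalar_mx_block add_block_mx !add0r.
(* The last column of the second factor clears the last column of s + g. *)
exists (block_mx u (- (invmx A *m ursubmx g)) 0 1%:M); split=> i j.
  case: (split_ordP i) => i' ->; case: (split_ordP j) => j' -> /=.
  - by rewrite block_mxEul (inj_eq (@lshift_inj _ _)); exact: uu.
  - by rewrite leqNgt ltn_addr.
  - by rewrite block_mxEdl eq_rlshift mxE.
  - by rewrite block_mxEdr (inj_eq (@rshift_inj _ _)) mxE.
rewrite gE mulmx_block.
case: (split_ordP i) => i' ->; case: (split_ordP j) => j' -> /=.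
- by rewrite block_mxEul mulmx0 addr0; exact: lu.
- by rewrite block_mxEur mulmxN mulKVmx // mulmx1 addNr mxE.
- by rewrite ltnNge ltnW // ltn_addr.
- by rewrite !ord1 ltnn.
Qed.

End Triangular.

Section HighestWeight.
Variables (R : realType) (r : nat) (W : polyrep R r).
Local Notation C := (complex R).
Local Notation n := (rep_dim W).
Implicit Types v : 'I_r -> C.

(** Irreducibility, in the form used below: an invariant linear condition that
    holds for one nonzero vector holds for all. *)
Lemma irreducible_closed (S : 'cV[C]_n -> Prop) (x0 : 'cV[C]_n) :
    irreducible_rep W -> S 0 ->
    (forall a x y, S x -> S y -> S (a *: x + y)) ->
    (forall g x, g \in unitmx -> S x -> S (rep_act W g *m x)) ->
    x0 != 0 -> S x0 ->
  forall x, S x.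
Proof.
move=> [_ irr] S0 Slin SG nz_x0 Sx0 x.
have [X XS] := vspace_of_closed S0 Slin.
have [|X0|Xf] := irr X.
- by move=> g ug y /XS Sy; apply/XS/SG.
- by move/XS: Sx0; rewrite X0 memv0 (negbTE nz_x0).
- by apply/XS; rewrite Xf memvf.
Qed.

Variables (lam : 'X_{1..r}) (w : 'cV[C]_n).
Hypotheses (irrW : irreducible_rep W) (nz_w : w != 0).
Hypothesis lam_w : weight_vector lam w.
Hypothesis upper_w : forall g, upper_unitriangular g -> rep_act W g *m w = w.

Lemma rep_tor_hw v : (forall i, v i != 0) ->
  rep_act W (tor v) *m w = torus_mnm v lam *: w.
Proof.
move=> v0; rewrite lam_w => [|i]; last by rewrite mxE.
by congr (_ *: _); apply: eq_bigr => i _; rewrite mxE.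
Qed.

Lemma lie_unit_raise (i j : 'I_r) : (i < j)%N -> lie_unit W i j *m w = 0.
Proof.
move=> ij; have : rep_curve W (line (delta_mx i j)) *m map_mx polyC w = map_mx polyC w.
  apply: (polymx_eq_generic (oner_neq0 _)) => s _.
  rewrite hmxM hmx_rep_curve !hmxC hmx_line; apply: upper_w => a b ba.
  rewrite !mxE; case: (a =P i) => [ai|_]; last by rewrite mulr0 addr0.
  case: (b =P j) => [bj|_]; last by rewrite mulr0 addr0.
  by move: ij; rewrite -ai -bj ltnNge ba.
move/(congr1 (@cmx _ 1 _ _)); rewrite cmx1M cmx1_rep_curve ?cmx0_line //.
by rewrite cmx1_line !cmxC scale0r mulmx0 add0r scale1r.
Qed.

Lemma lie_unit_hw i : lie_unit W i i *m w = (lam i)%:R *: w.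
Proof.
have /weight_vectorP <- := lam_w.
by rewrite mulmxA lie_unit_wproj -scalemxAl.
Qed.

Definition casimir_coef (i j : 'I_r) : C :=
  if i == j then (lam i)%:R ^+ 2
  else if (i < j)%N then (lam i)%:R - (lam j)%:R else 0.

Definition casimir_scalar := \sum_i \sum_j casimir_coef i j.

Lemma casimir_hw : casimir W *m w = casimir_scalar *: w.
Proof.
rewrite mulmx_suml scaler_suml; apply: eq_bigr => i _.
rewrite mulmx_suml scaler_suml; apply: eq_bigr => j _.
rewrite -mulmxA /casimir_coef; have [<-|ij] := eqVneq i j.
  by rewrite lie_unit_hw -scalemxAr lie_unit_hw scalerA expr2.
case: ltngtP => [lt_ij|lt_ji|/val_inj eq_ij]; last by rewrite eq_ij eqxx in ij.
  apply/eqP; rewrite scalerBl -!lie_unit_hw -mulmxBl -lie_unit_comm // mulmxBl.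
  by rewrite -!mulmxA (lie_unit_raise lt_ij) mulmx0 subr0.
by rewrite (lie_unit_raise lt_ji) mulmx0 scale0r.
Qed.

(** Schur's lemma: the eigenspace of w is invariant, as the Casimir element
    commutes with the group. *)
Lemma casimirE : casimir W = casimir_scalar%:M.
Proof.
pose S (x : 'cV[C]_n) := casimir W *m x = casimir_scalar *: x.
have allS : forall x, S x.
  apply: (@irreducible_closed S w) => //; rewrite /S.
  - by rewrite mulmx0 scaler0.
  - move=> a x y Sx Sy.
    by rewrite mulmxDr -scalemxAr Sx Sy scalerDr !scalerA mulrC.
  - by move=> g x ug Sx; rewrite mulmxA -casimir_central // -mulmxA Sx scalemxAr.
  - exact: casimir_hw.
apply/matrixP => i j.
have := congr1 (fun M : 'cV_n => M i 0) (allS (delta_mx j 0)).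
by rewrite -colE !mxE eqxx andbT mulr_natr.
Qed.

(** The upper unitriangular matrices fix w, so phi rho(g) w vanishes on the
    dense set of products of a lower and an upper triangular matrix, hence
    everywhere; the vectors rho(g) w span W. *)
Lemma functional_eq0 (phi : 'rV[C]_n) :
  (forall b, b \in unitmx -> lower_triangular b -> phi *m rep_act W b *m w = 0) ->
  phi = 0.
Proof.
move=> phib.
have phig (g : 'M[C]_r) : phi *m rep_act W g *m w = 0.
  pose G : 'M[{poly C}]_r := 'X%:M + map_mx polyC g.
  have [q q0 qP] := generic_lower_upper g.
  have : map_mx polyC phi *m rep_curve W G *m map_mx polyC w = 0.
    apply: (polymx_eq_generic (mulf_neq0 q0 (det_shift_neq0 g))) => s.
    rewrite hornerM mulf_eq0 negb_or => /andP[/qP[u [uu lu]] /hmx_unit uG].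
    rewrite !hmxM hmx_rep_curve !hmxC; move: uG; rewrite hmx_shift => uG.
    have u1 : u \in unitmx.
      rewrite -unitmx_tr unitmxE det_trig; last first.
        apply/is_trig_mxP => i j ij; rewrite mxE uu 1?ltnW //.
        by case: eqP ij => // ->; rewrite ltnn.
      by rewrite big1 ?unitr1 // => i _; rewrite mxE uu // eqxx.
    rewrite -(upper_w (g := u)) // mulmxA -[phi *m _ *m _]mulmxA.
    rewrite -rep_actM // phib ?unitmx_mul ?uG //.
    by apply/matrixP => i j; rewrite !mxE /horner_eval horner0.
  move/(congr1 (@hmx _ 0 _ _)); rewrite !hmxM hmx_rep_curve !hmxC hmx_shift.
  have -> : 0%:M + g = g by rewrite raddf0 add0r.
  move=> ->.
  by apply/matrixP => i j; rewrite !mxE /horner_eval horner0.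
pose S (x : 'cV[C]_n) := forall g, g \in unitmx -> phi *m rep_act W g *m x = 0.
have allS : forall x, S x.
  apply: (@irreducible_closed S w) => //; rewrite /S.
  - by move=> g _; rewrite mulmx0.
  - by move=> a x y Sx Sy g ug; rewrite mulmxDr -scalemxAr Sx // Sy // scaler0 addr0.
  - move=> g x ug Sx h uh; rewrite mulmxA -[phi *m _ *m _]mulmxA -rep_actM //.
    by rewrite Sx // unitmx_mul uh.
apply/matrixP => i j; rewrite ord1.
have := congr1 (fun M : 'M_1 => M 0 0) (allS (delta_mx j 0) 1%:M (unitmx1 _ _)).
by rewrite rep_act1 mulmx1 -colE !mxE.
Qed.

(** Let T be the torus element with entries s^(e_i). It acts on phi with
    weight l and on w with weight lam, so passing from b to its conjugate by T
    multiplies phi rho(b) w by a power of s. If the conjugate extends to a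
    polynomial curve B, this becomes an identity of polynomials in s. *)
Lemma tor_conj_curve (phi : 'rV[C]_n) l (b : 'M[C]_r) (B : 'M[{poly C}]_r)
    (e : 'I_r -> nat) :
    phi *m wproj W l = phi -> b \in unitmx ->
    (forall s, s != 0 ->
      tor (fun i => s ^+ e i) *m hmx s B = b *m tor (fun i => s ^+ e i)) ->
  'X^(\sum_i e i * l i) *: (map_mx polyC phi *m rep_curve W B *m map_mx polyC w)
  = 'X^(\sum_i e i * lam i) *: map_mx polyC (phi *m rep_act W b *m w).
Proof.
move=> phil ub TB; apply: (@polymx_eq_generic _ _ _ _ _ 'X).
  by rewrite polyX_eq0.
move=> s; rewrite hornerX => s0.
pose T := tor (fun i => s ^+ e i).
have T0 i : s ^+ e i != 0 by rewrite expf_neq0.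
have uT : T \in unitmx by exact: tor_unit.
have {}TB : T *m hmx s B = b *m T := TB s s0.
have uB : hmx s B \in unitmx.
  by have := unitmx_mul T (hmx s B); rewrite TB unitmx_mul ub uT => /esym.
have hmxZ m (A : 'M[{poly C}]_(1, m)) k : hmx s ('X^k *: A) = s ^+ k *: hmx s A.
  by apply/matrixP => i j; rewrite !mxE /horner_eval hornerM hornerXn.
have Tm m : \prod_i (s ^+ e i) ^+ (m i) = s ^+ (\sum_i e i * m i) :> C.
  elim/big_ind2: _ => // [x x' y y' -> ->|i _]; first by rewrite exprD.
  by rewrite exprM.
rewrite !hmxZ !hmxM hmx_rep_curve !hmxC -!Tm.
have <- : phi *m rep_act W T *m rep_act W (hmx s B) *m w
  = \prod_i (s ^+ e i) ^+ l i *: (phi *m rep_act W (hmx s B) *m w).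
  by rewrite -{1}phil -(mulmxA phi) wproj_tor // -scalemxAr phil !scalemxAl.
rewrite -(mulmxA phi) -(rep_actM W uT uB) TB (rep_actM W ub uT) -!mulmxA.
by rewrite rep_tor_hw // -!scalemxAr.
Qed.

Lemma left_weight_lower (phi : 'rV[C]_n) : phi != 0 ->
  exists b : 'M[C]_r,
    [/\ b \in unitmx, lower_triangular b & (phi *m rep_act W b *m w) != 0].
Proof.
move=> nz_phi; apply: contrapT => nb; case/eqP: nz_phi.
apply: functional_eq0 => b ub lb; apply/eqP; apply: contraT => bw.
by case: nb; exists b.
Qed.

(** Take e to be the indicator of the first k indices: conjugation multiplies
    the entries of the lower left block of b by s and fixes the others. Then
    compare the orders of vanishing at s = 0. *)
Lemma left_weight_dominated (phi : 'rV[C]_n) l k : phi != 0 ->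
  phi *m wproj W l = phi -> (psum l k <= psum lam k)%N.
Proof.
move=> /left_weight_lower[b [ub lb bw]] phil.
pose B : 'M[{poly C}]_r :=
  \matrix_(i, j) ((b i j)%:P * (if (j < k <= i)%N then 'X else 1)).
pose e (i : 'I_r) : nat := (i < k)%N.
have eE (m : 'X_{1..r}) : (\sum_i e i * m i = psum m k)%N.
  rewrite /psum [RHS]big_mkcond; apply: eq_bigr => i _.
  by rewrite /e; case: ltnP; rewrite ?mul1n.
have TB (s : C) : s != 0 ->
    tor (fun i => s ^+ e i) *m hmx s B = b *m tor (fun i => s ^+ e i).
  move=> s0; rewrite mul_diag_mx mul_mx_diag; apply/matrixP => i j.
  rewrite !mxE /horner_eval hornerM hornerC /e.
  have [ij|ji] := ltnP i j; first by rewrite lb // !mul0r mulr0.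
  rewrite (_ : (if _ then 'X else 1).[s] = if (j < k <= i)%N then s else 1);
    last by case: (_ && _); rewrite ?hornerX ?hornerC.
  case: (ltnP i k) => ik; case: (ltnP j k) => jk /=; rewrite ?mulr1 ?mul1r //.
  - by rewrite mulrC.
  - by move: (leq_trans ik jk); rewrite ltnNge ji.
have := tor_conj_curve phil ub TB; rewrite !eE => eq_p.
move: eq_p bw; move: (phi *m rep_act W b *m w) => f eq_p bw.
have [[i j] /= bij] : exists ij, f ij.1 ij.2 != 0.
  exists (0, 0); apply: contra_neq bw => bw; apply/matrixP => i j.
  by rewrite !ord1 bw mxE.
have := congr1 (fun M : 'M[{poly C}]_1 => (M i j)`_(psum lam k)) eq_p.
rewrite !mxE coefXnM coefXnM ltnn subnn coefC eqxx.
by case: ltnP => // _ /esym/eqP; rewrite (negbTE bij).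
Qed.

(** Scalar matrices act on phi through the degree of l, and on w through the
    degree of lam. *)
Lemma left_weight_mdeg (phi : 'rV[C]_n) l : phi != 0 ->
  phi *m wproj W l = phi -> mdeg l = mdeg lam.
Proof.
move=> /left_weight_lower[b [ub lb bw]] phil.
have TB (s : C) : s != 0 -> tor (fun=> s ^+ 1) *m hmx s (map_mx polyC b)
    = b *m tor (fun=> s ^+ 1).
  move=> s0; rewrite hmxC mul_diag_mx mul_mx_diag; apply/matrixP => i j.
  by rewrite !mxE mulrC.
have := @tor_conj_curve phi l b _ (fun=> 1%N) phil ub TB.
rewrite rep_curveC -!map_mxM => eq_p.
have eE (m : 'X_{1..r}) : (\sum_(i < r) 1 * m i = mdeg m)%N.
  by rewrite mdegE; apply: eq_bigr => i _; rewrite mul1n.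
move: eq_p bw; move: (phi *m rep_act W b *m w) => f eq_p bw.
have [[i j] /= bij] : exists ij, f ij.1 ij.2 != 0.
  exists (0, 0); apply: contra_neq bw => bw; apply/matrixP => i j.
  by rewrite !ord1 bw mxE.
have := congr1 (fun M : 'M[{poly C}]_1 => (M i j)`_(mdeg lam)) eq_p.
rewrite !eE !mxE !coefMC !coefXn eqxx mul1r [_ == mdeg l]eq_sym.
by have [//|_] := eqVneq (mdeg l); rewrite mul0r => /esym/eqP/(negP bij).
Qed.

(** For decreasing e, the conjugates of b tend to the diagonal of b as s tends
    to 0, while phi rho(-) w stays constant along the curve. On diagonal
    matrices this function is a multiple of phi w. *)
Lemma left_highest_weight (phi : 'rV[C]_n) :
  phi *m wproj W lam = phi -> phi *m w = 0 -> phi = 0.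
Proof.
move=> phil phiw; apply: functional_eq0 => b ub lb.
pose B : 'M[{poly C}]_r := \matrix_(i, j) ((b i j)%:P * 'X^(i - j)).
(* Conjugation by T multiplies the entry (i, j) of b by s^(i - j). *)
pose e (i : 'I_r) : nat := rev_ord i.
have TB (s : C) : s != 0 ->
    tor (fun i => s ^+ e i) *m hmx s B = b *m tor (fun i => s ^+ e i).
  move=> s0; rewrite mul_diag_mx mul_mx_diag; apply/matrixP => i j.
  rewrite !mxE /horner_eval hornerM hornerC hornerXn /e /=.
  have [ij|ji] := ltnP i j; first by rewrite lb // !mul0r mulr0.
  rewrite mulrCA -exprD; congr (_ * _ ^+ _).
  by have := ltn_ord i; lia.
have eq_p := tor_conj_curve phil ub TB.
have : map_mx polyC phi *m rep_curve W B *m map_mx polyC w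
    = map_mx polyC (phi *m rep_act W b *m w).
  apply/matrixP => i j; have := congr1 (fun M : 'M[{poly C}]_1 => M i j) eq_p.
  by rewrite [LHS]mxE [RHS]mxE => /(mulfI (expf_neq0 _ (negbT (polyX_eq0 _)))).
move/(congr1 (@hmx _ 0 _ _)); rewrite !hmxM hmx_rep_curve !hmxC => <-.
have -> : hmx 0 B = tor (fun i => b i i).
  apply/matrixP => i j; rewrite !mxE /horner_eval hornerM hornerC hornerXn.
  have [<-|ij] := eqVneq i j; first by rewrite subnn mulr1.
  have [lt_ij|le_ji] := ltnP i j; first by rewrite lb // mul0r.
  rewrite expr0n subn_eq0 leqNgt ltn_neqAle le_ji andbT eq_sym ij.
  by rewrite mulr0.
(* At s = 0 the curve is at the diagonal part of b. *)
rewrite -mulmxA rep_tor_hw => [|i]; first by rewrite -scalemxAr phiw scaler0.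
move: ub; rewrite unitmxE det_trig ?unitfE; last exact/is_trig_mxP.
by move/prodf_neq0/(_ i isT).
Qed.

Lemma wproj_eq0 l : ~~ [forall k : 'I_r.+1, (psum l k <= psum lam k)%N] ||
  (mdeg l != mdeg lam) -> wproj W l = 0.
Proof.
move=> nl; apply/row_matrixP => i; rewrite row0; apply/eqP; apply: contraLR nl.
move=> nz_row; have rowl : row i (wproj W l) *m wproj W l = row i (wproj W l).
  by rewrite -row_mul wprojM eqxx scale1r.
rewrite (left_weight_mdeg nz_row rowl) eqxx orbF negbK.
by apply/forallP => k; exact: left_weight_dominated rowl.
Qed.

(** By [left_highest_weight], a functional of weight lam is determined by its
    value on w, so wproj lam has rank one. *)
Lemma tr_wproj_hw : \tr (wproj W lam) = 1.
Proof.
have wlam : wproj W lam *m w = w by exact/weight_vectorP.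
have [i wi] : exists i, w i 0 != 0.
  apply: contrapT => nw; case/eqP: nz_w; apply/colP => i; rewrite mxE.
  by apply/eqP; apply: contraT => wi; case: nw; exists i.
pose psi : 'rV[C]_n := (w i 0)^-1 *: delta_mx 0 i *m wproj W lam.
have psil : psi *m wproj W lam = psi.
  by rewrite /psi -mulmxA wprojM eqxx scale1r.
have psiw : psi *m w = 1%:M.
  rewrite /psi -mulmxA wlam -scalemxAl -rowE.
  by apply/matrixP => a b; rewrite !ord1 !mxE mulVf.
clearbody psi; have -> : wproj W lam = w *m psi.
  apply/row_matrixP => k; rewrite rowE [RHS]rowE; apply/subr0_eq.
  apply: left_highest_weight.
    by rewrite mulmxBl -!mulmxA psil wprojM eqxx scale1r.
  by rewrite mulmxBl -!mulmxA wlam psiw mulmx1 subrr.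
by rewrite mxtrace_mulC psiw mxtrace1.
Qed.

End HighestWeight.

(** * Alternants and the Weyl character formula *)

Section Conjugation.
Variables (A : comNzRingType) (r : nat) (x : 'I_r -> A) (D : 'I_r -> A -> A).
Hypothesis DD : forall i u v, D i (u + v) = D i u + D i v.
Hypothesis DM : forall i u v, D i (u * v) = D i u * v + u * D i v.

(** The radial part of the Casimir element. The hypotheses on Y express the
    trace of t E_ij E_ji through the character chi, and B i j is the quotient of
    the Vandermonde a by x_i - x_j; multiplication by a turns the first order
    terms of the operator into the cross terms of the Leibniz rule. *)
Lemma laplacian_conj (chi a : A) (Y B : 'I_r -> 'I_r -> A) :
    (forall i j, i != j -> (x i - x j) * Y i j = x i * (D i chi - D j chi)) ->
    (forall i, Y i i = D i (D i chi)) ->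
    (forall i j, i != j -> a = (x i - x j) * B i j) ->
    (forall i j, i != j -> B i j = - B j i) ->
    (forall i, D i a = \sum_(j | j != i) x i * B i j) ->
  \sum_i D i (D i (chi * a)) + (\sum_i D i chi) * a
  = a * (\sum_i \sum_j Y i j) + r%:R * (\sum_i D i chi) * a
    + chi * \sum_i D i (D i a).
Proof.
move=> YE Yii aE BN Da.
have aY i j : i != j -> a * Y i j = x i * B i j * D i chi - x i * B i j * D j chi.
  move=> ij; rewrite {1}(aE _ _ ij) mulrAC YE //; ring.
have xB i j : i != j -> x i * B i j = a - x j * B j i.
  by move=> ij; rewrite (aE _ _ ij) [B j i]BN 1?eq_sym //; ring.
have S1 : a * (\sum_i \sum_j Y i j) = a * (\sum_i D i (D i chi))
    + \sum_i D i a * D i chi - \sum_i \sum_(j | j != i) x i * B i j * D j chi.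
  rewrite !big_distrr -big_split -sumrB; apply: eq_bigr => i _ /=.
  rewrite (bigD1 i) //= Yii mulrDr -addrA; congr (_ + _).
  rewrite Da big_distrl big_distrr -sumrB; apply: eq_bigr => j ji /=.
  by rewrite aY 1?eq_sym.
have S2 : \sum_i \sum_(j | j != i) x i * B i j * D j chi
    = r%:R * (\sum_j D j chi) * a - (\sum_j D j chi) * a
      - \sum_j D j a * D j chi.
  rewrite (exchange_big_dep xpredT) //= !(big_distrr, big_distrl) -!sumrB /=.
  apply: eq_bigr => j _; rewrite Da -big_distrl /=.
  under eq_bigl do rewrite eq_sym.
  under eq_bigr => i ij do rewrite xB //.
  rewrite sumrB sumr_const -[#|_|]/(#|predC1 j|) cardC1 card_ord.
  have -> : r%:R = 1 + r.-1%:R :> A.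
    by rewrite nat1r prednK // (leq_ltn_trans _ (ltn_ord j)).
  by rewrite -mulr_natl; move: (\sum_(i | _) _) => S; ring.
rewrite S1 S2.
have -> : \sum_i D i (D i (chi * a)) = a * (\sum_i D i (D i chi))
    + 2%:R * (\sum_i D i a * D i chi) + chi * \sum_i D i (D i a).
  rewrite !big_distrr -!big_split; apply: eq_bigr => i _ /=.
  by rewrite !(DM, DD); ring.
by ring.
Qed.
End Conjugation.

Lemma summation_by_parts (f c : nat -> int) n :
  \sum_(i < n.+1) f i * c i = (\sum_(i < n.+1) f i) * c n
    + \sum_(k < n) (\sum_(i < k.+1) f i) * (c k - c k.+1).
Proof.
elim: n => [|n IHn]; first by rewrite !big_ord1 big_ord0 addr0.
rewrite big_ord_recr /= IHn [in RHS]big_ord_recr /= [X in _ = _ + X]big_ord_recr /=.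
by ring.
Qed.

(** Summation by parts writes the last sum as a sum of nonnegative terms, each
    a partial sum of f times a positive number; so all partial sums are zero. *)
Lemma dominance_norm_eq (f c : nat -> int) n :
    (forall k, (k <= n)%N -> 0 <= \sum_(i < k) f i) -> \sum_(i < n) f i = 0 ->
    (forall k, (k.+1 < n)%N -> c k.+1 < c k) ->
    \sum_(i < n) f i * c i = 0 ->
  forall k, (k < n)%N -> f k = 0.
Proof.
case: n => // n S0 Sn cdec; rewrite summation_by_parts Sn mul0r add0r => eq0.
have Sk k : (k <= n.+1)%N -> \sum_(i < k) f i = 0.
  rewrite leq_eqVlt => /predU1P[->//|]; rewrite ltnS.
  case: k => [_|k kn]; first by rewrite big_ord0.
  have /eqP : (\sum_(i < k.+1) f i) * (c k - c k.+1) = 0.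
    have ge0 (i : 'I_n) : true ->
        0 <= (\sum_(i0 < i.+1) f i0) * (c i - c i.+1).
      move=> _; apply: mulr_ge0; first by apply: S0; rewrite ltnW // ltnS.
      by rewrite subr_ge0 ltW // cdec // ltnS.
    exact: (psumr_eq0P ge0 eq0 (i := Ordinal kn)).
  by rewrite mulf_eq0 subr_eq0 (gt_eqF (cdec k kn)) orbF => /eqP.
move=> k kn; have := Sk k.+1 kn; rewrite big_ord_recr /= Sk ?add0r //.
exact: ltnW.
Qed.

(** Compare with the threshold t = a k: for every i the indicators of
    s^-1 i < k and of i < k differ by a number whose product with a i - t is
    at most 0. *)
Lemma perm_partial_sum r (a : 'I_r -> nat) (s : 'S_r) k :
    (forall i j : 'I_r, (i <= j)%N -> (a j <= a i)%N) ->
  (\sum_(i < r | (i < k)%N) a (s i) <= \sum_(i < r | (i < k)%N) a i)%N.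
Proof.
move=> adec; have [kr|rk] := ltnP k r; last first.
  have kT (i : 'I_r) : (i < k)%N = true by exact: leq_trans rk.
  rewrite (eq_bigl _ _ kT) [leqRHS](eq_bigl _ _ kT).
  by rewrite [leqRHS](reindex_inj (@perm_inj _ s)).
pose t := a (Ordinal kr).
suff : (\sum_(i < r | (i < k)%N) a (s i))%:Z - (\sum_(i < r | (i < k)%N) a i)%:Z <= 0.
  by rewrite subr_le0 lez_nat.
pose b (P : bool) : int := P%:R.
have sumE (f : 'I_r -> nat) (P : pred 'I_r) :
    (\sum_(i | P i) f i)%:Z = \sum_i b (P i) * (f i)%:Z.
  rewrite (big_morph Posz PoszD (erefl 0%:Z)) big_mkcond; apply: eq_bigr => i _.
  by case: (P i); rewrite ?mul1r ?mul0r.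
have -> : (\sum_(i < r | (i < k)%N) a (s i))%:Z
    = \sum_i b (((s^-1)%g i < k)%N) * (a i)%:Z.
  rewrite sumE (reindex_inj (@perm_inj _ s^-1%g)) /=.
  by apply: eq_bigr => i _; rewrite permKV.
have cards : \sum_i b (((s^-1)%g i < k)%N) = \sum_(i < r) b ((i < k)%N).
  by rewrite [RHS](reindex_inj (@perm_inj _ s^-1%g)).
rewrite sumE -sumrB.
have -> : \sum_i (b (((s^-1)%g i < k)%N) * (a i)%:Z - b ((i < k)%N) * (a i)%:Z)
    = \sum_i (b (((s^-1)%g i < k)%N) - b ((i < k)%N)) * ((a i)%:Z - t%:Z).
  apply/eqP; rewrite eq_sym -subr_eq0 -sumrB.
  under eq_bigr => i _ do rewrite -mulrBl mulrBr addrAC subrr add0r -mulrN.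
  by rewrite -big_distrl /= sumrB cards subrr mul0r.
apply: sumr_le0 => i _; have [ik|ki] := ltnP i k.
  have : (t <= a i)%N by apply: adec => /=; exact: ltnW.
  by case: (_ < k)%N; rewrite /b /=; lia.
have : (a i <= t)%N by exact: adec.
by case: (_ < k)%N; rewrite /b /=; lia.
Qed.

Definition alternant (A : comNzRingType) r (x : 'I_r -> A) (al : 'I_r -> nat) : A :=
  \det (\matrix_(i, j) x i ^+ al j).

(** The exponents delta = (r - 1, ..., 1, 0) of the Vandermonde determinant. *)
Definition staircase r (i : 'I_r) : nat := rev_ord i.

Section VandermondeDerivative.
Variables (K : comNzRingType) (r : nat).
Local Notation P := {mpoly K[r]}.

Let pairs : seq ('I_r * 'I_r) :=
  [seq p : 'I_r * 'I_r <- index_enum ('I_r * 'I_r)%type | (p.1 < p.2)%N].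
Let F (p : 'I_r * 'I_r) : P := 'X_p.2 - 'X_p.1.
Let rest (p : 'I_r * 'I_r) : P := \prod_(q <- pairs | q != p) F q.

(** The Vandermonde determinant is, up to sign, the product of the differences
    X_j - X_i, and the Leibniz rule gives its logarithmic derivatives. *)
Lemma alternant_staircase_derivative :
  exists B : 'I_r -> 'I_r -> P, let a := alternant (fun i => 'X_i) (@staircase r) in
  [/\ forall i j, i != j -> a = ('X_i - 'X_j) * B i j,
      forall i j, i != j -> B i j = - B j i &
      forall i, euler i a = \sum_(j | j != i) 'X_i * B i j].
Proof.
pose rev := perm (@rev_ord_inj r).
pose V := Vandermonde r (\row_i ('X_i : P)).
pose e : P := (-1) ^+ odd_perm rev.
have aE : alternant (fun i => 'X_i) (@staircase r) = e * \prod_(p <- pairs) F p.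
  have -> : alternant (fun i => 'X_i) (@staircase r) = \det (row_perm rev V).
    rewrite -[RHS]det_tr; congr (\det _); apply/matrixP => i j.
    by rewrite !mxE permE.
  rewrite row_permE det_mulmx det_perm det_Vandermonde /e; congr (_ * _).
  rewrite pair_big_dep /= /pairs big_filter; apply: eq_bigr => -[i j] _.
  by rewrite !mxE.
have upairs : uniq pairs by rewrite filter_uniq // index_enum_uniq.
have in_pairs p : p \in pairs = (p.1 < p.2)%N.
  by rewrite mem_filter mem_index_enum andbT.
have restE p : p \in pairs -> \prod_(q <- pairs) F q = F p * rest p.
  by move=> pp; rewrite (bigD1_seq p).
pose B (i j : 'I_r) := if (j < i)%N then e * rest (j, i) else - (e * rest (i, j)).
exists B; rewrite aE; split=> [i j ij|i j ij|i].
- rewrite /B; case: ltnP => ji.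
    by rewrite (restE (j, i)) ?in_pairs //= mulrCA.
  have {ij ji} ij : (i < j)%N by rewrite ltn_neqAle ij.
  by rewrite (restE (i, j)) ?in_pairs //= mulrN -mulNr opprB mulrCA.
- rewrite /B; case: (ltngtP i j) ij => [_ _|_ _|/val_inj ->];
    by rewrite ?opprK ?eqxx.
- have euler_sign (p : P) : euler i (e * p) = e * euler i p.
    rewrite /e mulr_sign; case: odd_perm.
      by rewrite linearN /= expr1 mulN1r.
    by rewrite expr0 mul1r.
  rewrite euler_sign (@derivation_prod _ (euler i) _ _ F (euler1 _ i) (eulerM i) upairs).
  transitivity (\sum_(p <- pairs) ((i == p.2)%:R * ('X_i * (e * rest p))
      - (i == p.1)%:R * ('X_i * (e * rest p)))).
    rewrite big_distrr; apply: eq_bigr => p _ /=; rewrite linearB /= !eulerX.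
    have h j : (i == j)%:R * 'X_j = (i == j)%:R * 'X_i :> P.
      by case: eqP => [->|_]; rewrite ?mul0r.
    by rewrite !h -/(rest p); ring.
  rewrite sumrB !big_filter.
  rewrite -(pair_big_dep xpredT (fun a b : 'I_r => (a < b)%N) (fun a b =>
    (i == b)%:R * ('X_i * (e * rest (a, b))))) /=.
  rewrite -(pair_big_dep xpredT (fun a b : 'I_r => (a < b)%N) (fun a b =>
    (i == a)%:R * ('X_i * (e * rest (a, b))))) /=.
  rewrite [X in _ - X](bigD1 i) //= [X in _ - (_ + X)]big1 ?addr0; last first.
    by move=> j ji; rewrite big1 // => k _; rewrite eq_sym (negbTE ji) mul0r.
  rewrite (exchange_big_dep xpredT) //= (bigD1 i) //= [X in (_ + X) - _]big1 ?addr0;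
    last by move=> j ji; rewrite big1 // => k _; rewrite eq_sym (negbTE ji) mul0r.
  rewrite [RHS](bigID (fun j : 'I_r => (j < i)%N)) /=; congr (_ + _).
    apply: eq_big => j; first by rewrite -(inj_eq val_inj) /=; case: ltngtP.
    by move=> ji; rewrite eqxx mul1r /B ji.
  rewrite -sumrN; apply: eq_big => j.
    by rewrite -(inj_eq val_inj) /=; case: ltngtP.
  by move=> ij; rewrite eqxx mul1r /B ltnNge ltnW //= mulrN.
Qed.

End VandermondeDerivative.

Section AlternantCoefficients.
Variables (K : comNzRingType) (r : nat).
Implicit Types (al : 'I_r -> nat) (s : 'S_r) (p : {mpoly K[r]}).

Definition perm_mnm al s : 'X_{1..r} := [multinom al (s i) | i < r].

Lemma alternantE al : alternant (fun i => 'X_i : {mpoly K[r]}) al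
  = \sum_(s : 'S_r) (-1) ^+ s *: 'X_[perm_mnm al s].
Proof.
apply: eq_bigr => s _; rewrite -mul_mpolyC rmorphXn rmorphN rmorph1; congr (_ * _).
by rewrite mpolyXE_id; apply: eq_bigr => i _; rewrite mxE mnmE.
Qed.

Lemma msym_alternant al s : msym s (alternant (fun i => 'X_i : {mpoly K[r]}) al)
  = (-1) ^+ s * alternant (fun i => 'X_i) al.
Proof.
rewrite /alternant -det_map_mx -det_perm -det_mulmx -row_permE.
congr (\det _); apply/matrixP => i j; rewrite !mxE rmorphXn /=; congr (_ ^+ _).
by rewrite /msym mmapX mmap1U.
Qed.

Lemma mcoeff_mulX p m k :
  (p * 'X_[k])@_m = if (k <= m)%MM then p@_(m - k) else 0.
Proof.
case: ifP => km; first by rewrite -{1}(submK km) addmC mcoeffMX.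
apply/memN_msupp_eq0; rewrite (perm_mem (msuppMX _ _)).
by apply/mapP => -[m' _ mE]; rewrite mE lem_addr in km.
Qed.

Lemma mcoeff_mul_alternant p al m :
  (p * alternant (fun i => 'X_i) al)@_m = \sum_(s : 'S_r) (-1) ^+ s *
    (if (perm_mnm al s <= m)%MM then p@_(m - perm_mnm al s) else 0).
Proof.
rewrite alternantE big_distrr raddf_sum; apply: eq_bigr => s _ /=.
by rewrite -scalerAr mcoeffZ mcoeff_mulX.
Qed.

Lemma mcoeff_alternant al m : (alternant (fun i => 'X_i : {mpoly K[r]}) al)@_m
  = \sum_(s : 'S_r) (-1) ^+ s * (perm_mnm al s == m)%:R.
Proof.
rewrite alternantE raddf_sum; apply: eq_bigr => s _ /=.
by rewrite mcoeffZ mcoeffX.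
Qed.

Lemma perm_mnmE al s i : perm_mnm al s i = al (s i).
Proof. exact: mnmE. Qed.

Lemma perm_mnm1 al i : perm_mnm al 1%g i = al i.
Proof. by rewrite perm_mnmE perm1. Qed.

Lemma psum_perm_mnm al s k : (forall i j : 'I_r, (i <= j)%N -> (al j <= al i)%N) ->
  (psum (perm_mnm al s) k <= psum (perm_mnm al 1%g) k)%N.
Proof.
have psumE t : psum (perm_mnm al t) k = (\sum_(i < r | (i < k)%N) al (t i))%N.
  by apply: eq_bigr => i _; exact: perm_mnmE.
move=> adec; rewrite !psumE [leqRHS](eq_bigr al) ?perm_partial_sum //.
by move=> i _; rewrite perm1.
Qed.

Lemma mdeg_perm_mnm al s : mdeg (perm_mnm al s) = mdeg (perm_mnm al 1%g).
Proof.
rewrite !mdegE [RHS](reindex_inj (@perm_inj _ s)).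
by apply: eq_bigr => i _; rewrite perm_mnm1 perm_mnmE.
Qed.

Lemma perm_mnm_inj al s : injective al -> perm_mnm al s = perm_mnm al 1%g -> s = 1%g.
Proof.
move=> ali /mnmP h; apply/permP => i; apply: ali.
by have := h i; rewrite perm_mnm1 perm_mnmE perm1.
Qed.

Lemma mcoeff_alternant_id al : injective al ->
  (alternant (fun i => 'X_i : {mpoly K[r]}) al)@_(perm_mnm al 1%g) = 1.
Proof.
move=> ali; rewrite mcoeff_alternant (bigD1 1%g) //= odd_perm1 mul1r eqxx.
rewrite big1 ?addr0 // => s s1; case: eqP => [/(perm_mnm_inj ali) sE|].
  by rewrite sE eqxx in s1.
by rewrite mulr0.
Qed.

End AlternantCoefficients.

(** Exchanging two variables changes the sign of p. If the exponents at i < j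
    were equal the leading coefficient would be zero, and if they were
    increasing the exchanged monomial would be larger. *)
Lemma mlead_antisym_decr (K : numDomainType) r (p : {mpoly K[r]}) : p != 0 ->
    (forall s : 'S_r, msym s p = (-1) ^+ s * p) ->
  forall i j : 'I_r, (i < j)%N -> (mlead p j < mlead p i)%N.
Proof.
move=> nz_p asym i j lt_ij; set m := mlead p; rewrite ltnNge; apply/negP => le_ij.
have cm : p@_m != 0 by rewrite mleadc_eq0.
have neq_ij : i != j by rewrite -(inj_eq val_inj) ltn_eqF.
pose t := tperm i j; pose mt := [multinom m (t k) | k < r].
have pmt : p@_mt = - p@_m.
  rewrite -mcoeff_sym asym odd_tperm neq_ij expr1 mulN1r mcoeffN.
  by congr (- _@_ _).
have : (mt <= m)%O.
  by apply: msupp_le_mlead; rewrite mcoeff_msupp pmt oppr_eq0.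
move: le_ij; rewrite leq_eqVlt => /predU1P[eq_ij _|lt_m].
  have mtE : mt = m.
    by apply/mnmP => k; rewrite mnmE; case: tpermP => [->|->|].
  move/eqP: pmt; rewrite mtE -subr_eq0 opprK -mulr2n mulrn_eq0 /=.
  by rewrite (negbTE cm).
apply/negP; rewrite -ltNge; apply/ltmcP; first by rewrite mdeg_mperm.
exists i => [k lt_ki|]; last by rewrite mnmE tpermL.
by rewrite mnmE tpermD // neq_ltn ?lt_ki ?orbT // (ltn_trans lt_ki) ?orbT.
Qed.

(** The difference of the squared norms of ga and be is the scalar product of
    ga - be, whose partial sums are nonnegative, with the strictly decreasing
    sequence ga + be. *)
Lemma dominated_same_norm r (ga be : 'X_{1..r}) :
    (forall i j : 'I_r, (i < j)%N -> (ga j < ga i)%N) ->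
    (forall i j : 'I_r, (i < j)%N -> (be j < be i)%N) ->
    (forall k, psum be k <= psum ga k)%N -> mdeg be = mdeg ga ->
    (\sum_i be i ^ 2 = \sum_i ga i ^ 2)%N ->
  be = ga.
Proof.
move=> gdec bdec le_bg deg_bg norm_bg.
pose f k : int := (nth 0%N ga k)%:Z - (nth 0%N be k)%:Z.
pose c k : int := (nth 0%N ga k)%:Z + (nth 0%N be k)%:Z.
have sumf k : (k <= r)%N -> \sum_(i < k) f i = (psum ga k)%:Z - (psum be k)%:Z.
  move=> kr; rewrite sumrB !psum_nth //.
  by rewrite !(big_morph Posz PoszD (erefl 0%:Z)).
have f0 : forall k, (k < r)%N -> f k = 0.
  apply: (@dominance_norm_eq f c).
  - by move=> k kr; rewrite sumf // subr_ge0 lez_nat.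
  - by rewrite sumf // !psum_full deg_bg subrr.
  - move=> k kr; have kr' := ltnW kr.
    have := gdec (Ordinal kr') (Ordinal kr) (ltnSn _).
    have := bdec (Ordinal kr') (Ordinal kr) (ltnSn _).
    by rewrite !(mnm_nth 0%N) /= /c; lia.
  - transitivity ((\sum_i ga i ^ 2)%:Z - (\sum_i be i ^ 2)%:Z); last first.
      by rewrite norm_bg subrr.
    rewrite !(big_morph Posz PoszD (erefl 0%:Z)) -sumrB.
    apply: eq_bigr => i _; rewrite /f /c !(mnm_nth 0%N) !expnS !expn0 !muln1 !PoszM.
    by ring.
apply/mnmP => i; have := f0 i (ltn_ord i).
by rewrite /f !(mnm_nth 0%N); lia.
Qed.

Section WeylCharacter.
Variables (K : numFieldType) (r : nat).
Local Notation P := {mpoly K[r]}.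
Implicit Types (chi : P) (lam : 'X_{1..r}).

Definition shifted lam : 'I_r -> nat := fun i => (lam i + staircase i)%N.

Lemma staircase_decr (i j : 'I_r) : (i < j)%N -> (staircase j < staircase i)%N.
Proof. by rewrite /staircase /=; have := ltn_ord j; lia. Qed.

Lemma decr_inj (al : 'I_r -> nat) :
  (forall i j : 'I_r, (i < j)%N -> (al j < al i)%N) -> injective al.
Proof.
move=> adec i j eq_a; apply/val_inj; case: (ltngtP i j) => // /adec.
  by rewrite eq_a ltnn.
by rewrite eq_a ltnn.
Qed.

Lemma decr_noninc (al : 'I_r -> nat) :
  (forall i j : 'I_r, (i < j)%N -> (al j < al i)%N) ->
  forall i j : 'I_r, (i <= j)%N -> (al j <= al i)%N.
Proof.
move=> adec i j; rewrite leq_eqVlt => /predU1P[/val_inj-> //|/adec]; exact: ltnW.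
Qed.

Lemma euler2_norm p (N : K) :
    (forall m, p@_m != 0 -> (\sum_i m i ^ 2)%N%:R = N) ->
  \sum_i euler i (euler i p) = N *: p :> P.
Proof.
move=> pN; apply/mpolyP => m; rewrite raddf_sum mcoeffZ /=.
under eq_bigr do rewrite !mcoeff_euler mulrA -natrM mulnn.
rewrite -big_distrl -natr_sum /=.
by have [->|/pN ->] := eqVneq p@_m 0; rewrite ?mulr0.
Qed.

(** The hypotheses on chi and Y are those met by the character of an irreducible
    representation of highest weight lam, with Y i j the trace of t E_ij E_ji.
    The leading exponent of the difference of the two sides would be strictly
    decreasing, dominated by lam + delta and of the same norm, so equal to
    lam + delta, where both sides have coefficient 1. *)
Lemma weyl_character chi lam (Y : 'I_r -> 'I_r -> P) (c : K) :
    (forall s : 'S_r, msym s chi = chi) ->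
    (forall i j : 'I_r, (i <= j)%N -> (lam j <= lam i)%N) ->
    (forall i j, i != j -> 'X_j * Y i j = 'X_i * Y j i) ->
    (forall i j, i != j -> Y i j - Y j i = euler i chi - euler j chi) ->
    (forall i, Y i i = euler i (euler i chi)) ->
    \sum_i \sum_j Y i j = c *: chi ->
    (forall l, chi@_l != 0 ->
       mdeg l = mdeg lam /\ forall k, (psum l k <= psum lam k)%N) ->
    chi@_lam = 1 ->
  chi * alternant (fun i => 'X_i) (@staircase r)
  = alternant (fun i => 'X_i) (shifted lam).
Proof.
move=> chi_sym lam_dec Yx YE Yii Ysum chi_dom chi_lam.
set de := @staircase r; set a := alternant _ de.
have ga_dec (i j : 'I_r) : (i < j)%N -> (shifted lam j < shifted lam i)%N.
  move=> ij; rewrite /shifted -addnS leq_add ?lam_dec ?staircase_decr //.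
  exact: ltnW.
have de_le := decr_noninc staircase_decr.
set ga := perm_mnm (shifted lam) 1%g.
have gaE : ga = (lam + perm_mnm de 1%g)%MM.
  by apply/mnmP => i; rewrite mnmDE !perm_mnm1.
have dom_add l s : chi@_l != 0 -> forall k,
    (psum (l + perm_mnm de s)%MM k <= psum ga k)%N.
  move=> /chi_dom[_ ll] k; rewrite gaE !psumD leq_add ?ll //.
  exact: psum_perm_mnm.
have supp_dom m : (chi * a)@_m != 0 -> exists l s,
    chi@_l != 0 /\ m = (l + perm_mnm de s)%MM.
  rewrite mcoeff_mul_alternant => nz_m.
  have [s nz_s] : exists s : 'S_r,
      (if (perm_mnm de s <= m)%MM then chi@_(m - perm_mnm de s) else 0) != 0.
    apply/existsP; apply: contra_neqT nz_m; rewrite negb_exists => /forallP h.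
    by rewrite big1 // => s _; have := h s; rewrite negbK => /eqP ->; rewrite mulr0.
  move: nz_s; case: ifP => [le_sm nz_l|]; last by rewrite eqxx.
  by exists (m - perm_mnm de s)%MM, s; rewrite submK.
have coef_ga : (chi * a)@_ga = 1.
  rewrite mcoeff_mul_alternant (bigD1 1%g) //= odd_perm1 mul1r.
  rewrite gaE lem_addl addmK chi_lam big1 ?addr0 // => s s1.
  case: ifP => [le_s|_]; last by rewrite mulr0.
  set l := (_ - _)%MM; have [->|nz_l] := eqVneq chi@_l 0; first by rewrite mulr0.
  have lE : (lam + perm_mnm de 1%g = l + perm_mnm de s)%MM by rewrite submK.
  case/eqP: s1; apply: (perm_mnm_inj (decr_inj staircase_decr)).
  apply: psum_inj => k; apply/eqP; rewrite eqn_leq psum_perm_mnm //=.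
  have := congr1 (fun m => psum m k) lE; rewrite /= !psumD => e.
  rewrite -(leq_add2l (psum lam k)) e leq_add2r.
  by have [_] := chi_dom _ nz_l.
have norm_a m : a@_m != 0 ->
    (\sum_i m i ^ 2)%N%:R = (\sum_i de i ^ 2)%N%:R :> K.
  rewrite mcoeff_alternant => nz_m.
  have [s /eqP <-] : exists s : 'S_r, perm_mnm de s == m.
    apply/existsP; apply: contra_neqT nz_m; rewrite negb_exists => /forallP h.
    by rewrite big1 // => s _; rewrite (negbTE (h s)) mulr0.
  congr (_%:R); rewrite [RHS](reindex_inj (@perm_inj _ s)).
  by apply: eq_bigr => i _; rewrite perm_mnmE.
have Echi : \sum_i euler i chi = (mdeg lam)%:R *: chi.
  apply/mpolyP => m; rewrite raddf_sum mcoeffZ /=.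
  under eq_bigr do rewrite mcoeff_euler.
  rewrite -big_distrl -natr_sum -mdegE /=.
  by have [->|/chi_dom[-> _]] := eqVneq chi@_m 0; rewrite ?mulr0.
have [B [aB BN Da]] := alternant_staircase_derivative K r.
have YE' i j : i != j -> ('X_i - 'X_j) * Y i j = 'X_i * (euler i chi - euler j chi).
  by move=> ij; rewrite mulrBl Yx // -mulrBr YE.
have := laplacian_conj (fun i => linearD (@euler r K i)) (@eulerM r K)
  YE' Yii aB BN Da.
rewrite -/a Echi Ysum (euler2_norm norm_a) => lap.
(* The coefficient 1 at lam + delta identifies this constant with the squared
   norm of lam + delta. *)
pose ka : K := c + r%:R * (mdeg lam)%:R - (mdeg lam)%:R + (\sum_i de i ^ 2)%N%:R.
have {}lap : \sum_i euler i (euler i (chi * a)) = ka *: (chi * a).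
  apply: (addIr ((mdeg lam)%:R *: chi * a)); rewrite lap /ka.
  have -> : a * (c *: chi) = c *: (chi * a) by rewrite -scalerAr mulrC.
  have -> : r%:R * ((mdeg lam)%:R *: chi) * a = (r%:R * (mdeg lam)%:R) *: (chi * a).
    by rewrite -mulrA -scalerAl mulr_natl -scaler_nat scalerA.
  by rewrite -scalerAr -scalerAl -!scalerDl; congr (_ *: _); ring.
have norm_m m : (chi * a)@_m != 0 -> (\sum_i m i ^ 2)%N%:R = ka.
  move=> nz_m; apply: (mulIf nz_m); have := congr1 (mcoeff m) lap.
  rewrite raddf_sum mcoeffZ /= => <-; rewrite natr_sum big_distrl.
  by apply: eq_bigr => i _ /=; rewrite !mcoeff_euler mulrA -natrM mulnn.
have kaE : ka = (\sum_i ga i ^ 2)%N%:R.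
  by rewrite (norm_m ga) // coef_ga oner_neq0.
apply/eqP; rewrite -subr_eq0; apply: contraT => nz_F.
set F := chi * a - _ in nz_F; pose be := mlead F.
have be_dec : forall i j : 'I_r, (i < j)%N -> (be j < be i)%N.
  apply: mlead_antisym_decr => // s.
  by rewrite msymB msymM !msym_alternant chi_sym mulrCA -mulrBr.
have coef_be : F@_be != 0 by rewrite mleadc_eq0.
suff be_ga : be = ga.
  move: coef_be; rewrite be_ga mcoeffB coef_ga mcoeff_alternant_id ?subrr ?eqxx //.
  exact: decr_inj.
have ga_dec' (i j : 'I_r) : (i < j)%N -> (ga j < ga i)%N.
  by rewrite !perm_mnm1; exact: ga_dec.
have [z_b|nz_b] := eqVneq (chi * a)@_be 0; last first.
  have [l [s [nz_l beE]]] := supp_dom _ nz_b.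
  apply: dominated_same_norm => //.
  - by move=> k; rewrite beE; exact: dom_add.
  - rewrite beE gaE !mdegD mdeg_perm_mnm.
    by have [-> _] := chi_dom _ nz_l.
  - by apply/eqP; rewrite -(eqr_nat K) norm_m // kaE.
have [s /eqP beE] : exists s : 'S_r, perm_mnm (shifted lam) s == be.
  move: coef_be; rewrite mcoeffB z_b sub0r oppr_eq0 mcoeff_alternant => nz_m.
  apply/existsP; apply: contra_neqT nz_m; rewrite negb_exists => /forallP h.
  by rewrite big1 // => s _; rewrite (negbTE (h s)) mulr0.
apply: dominated_same_norm => //; rewrite -beE.
- by move=> k; apply: psum_perm_mnm; exact: decr_noninc.
- exact: mdeg_perm_mnm.
rewrite [RHS](reindex_inj (@perm_inj _ s)).
by apply: eq_bigr => i _; rewrite perm_mnm1 perm_mnmE.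
Qed.

End WeylCharacter.

(** * Characters of irreducible representations *)

Lemma meval_msym (R : comNzRingType) n (s : 'S_n) (p : {mpoly R[n]}) v :
  (msym s p).@[v] = p.@[fun i => v (s i)].
Proof.
rewrite /msym /mmap raddf_sum [RHS]mevalE; apply: eq_bigr => m _ /=.
rewrite mevalM mevalC rmorph_prod; congr (_ * _).
by apply: eq_bigr => i _ /=; rewrite rmorphXn /= mevalXU.
Qed.

Lemma complex_mpoly_eq (R : realType) r (p q : {mpoly (complex R)[r]}) :
  (forall v : 'I_r -> complex R, (forall i, v i != 0) -> p.@[v] = q.@[v]) -> p = q.
Proof. by move=> pq; apply: mpoly_eq_torus. Qed.

Section TracePolynomials.
Variables (R : realType) (r : nat) (W : polyrep R r).
Local Notation C := (complex R).
Local Notation n := (rep_dim W).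

(** The function t |-> tr(rho(t) M) on the torus, as a polynomial. *)
Definition trpoly (M : 'M[C]_n) : {mpoly C[r]} :=
  \tr (torus_mx W *m map_mx (@mpolyC r C) M).

Lemma meval_trpoly M v : (trpoly M).@[v] = \tr (rep_act W (tor v) *m M).
Proof.
rewrite /trpoly /mxtrace raddf_sum -torus_mxE; apply: eq_bigr => i _ /=.
rewrite mxE [RHS]mxE raddf_sum; apply: eq_bigr => k _ /=.
by rewrite mevalM !mxE mevalC.
Qed.

Lemma mcoeff_trpoly M l : (trpoly M)@_l = \tr (wproj W l *m M).
Proof.
rewrite /trpoly /mxtrace raddf_sum; apply: eq_bigr => i _ /=.
rewrite mxE [RHS]mxE raddf_sum; apply: eq_bigr => k _ /=.
by rewrite [X in (_ * X)@__]mxE mulrC mcoeffCM mulrC; congr (_ * _); rewrite [RHS]mxE.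
Qed.

(** Permutation matrices normalize the torus. *)
Lemma msym_torus_char (s : 'S_r) : msym s (torus_char W) = torus_char W.
Proof.
apply: mpoly_eq_torus => v v0; rewrite meval_msym !meval_torus_char.
have us : (perm_mx s : 'M[C]_r) \in unitmx by exact: unitmx_perm.
have -> : tor (fun i => v (s i)) = perm_mx s *m tor v *m invmx (perm_mx s).
  apply/(canRL (mulmxK us))/matrixP => i j.
  rewrite mul_diag_mx mul_mx_diag !mxE.
  by case: eqP => [->|_]; rewrite ?mulr0 ?mul0r // mulr1 mul1r.
rewrite !rep_actM ?unitmx_mul ?unitmx_inv ?us ?tor_unit //.
rewrite mxtrace_mulC mulmxA -rep_actM ?unitmx_inv // mulVmx //.
by rewrite rep_act1 mul1mx.
Qed.

Local Notation Y i j := (trpoly (lie_unit W i j *m lie_unit W j i)).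

(** Move rho(t) past E_ij, at the cost of the factor t_i / t_j, and use that
    the trace is cyclic. *)
Lemma trpoly_swap i j : i != j -> 'X_j * Y i j = 'X_i * Y j i.
Proof.
move=> ij; apply: complex_mpoly_eq => v v0; 
have := meval_trpoly (lie_unit W i j *m lie_unit W j i) v.
have := meval_trpoly (lie_unit W j i *m lie_unit W i j) v.
move: (Y i j) (Y j i) => p q.
move=> qE pE; rewrite 2!mevalM 2!mevalXU pE qE mulmxA tor_lie_unit //.
rewrite -!scalemxAl mxtraceZ mulrA mulrCA mulfV // mulr1.
by rewrite -mulmxA mxtrace_mulC mulmxA.
Qed.

Lemma trpoly_comm i j : i != j ->
  Y i j - Y j i = euler i (torus_char W) - euler j (torus_char W).
Proof.
move=> ij; apply/mpolyP => l.
have := mcoeff_trpoly (lie_unit W i j *m lie_unit W j i) l.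
have := mcoeff_trpoly (lie_unit W j i *m lie_unit W i j) l.
have := mcoeff_torus_char W l.
move: (Y i j) (Y j i) (torus_char W) => p q chi chiE qE pE.
rewrite !mcoeffB !mcoeff_euler chiE pE qE -linearB -mulmxBr lie_unit_comm //.
by rewrite mulmxBr !wproj_lie_unit linearB /= !linearZ.
Qed.

Lemma trpoly_diag i : Y i i = euler i (euler i (torus_char W)).
Proof.
apply/mpolyP => l; have := mcoeff_torus_char W l.
have := mcoeff_trpoly (lie_unit W i i *m lie_unit W i i) l.
move: (Y i i) (torus_char W) => p chi pE chiE.
rewrite !mcoeff_euler chiE pE.
by rewrite mulmxA wproj_lie_unit -scalemxAl wproj_lie_unit !linearZ.
Qed.

Lemma trpoly_casimir c : casimir W = c%:M ->
  \sum_i \sum_j Y i j = c *: torus_char W.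
Proof.
move=> casE; apply/mpolyP => l; have := mcoeff_torus_char W l.
have : (\sum_i \sum_j Y i j)@_l = \tr (wproj W l *m casimir W).
  rewrite /casimir mulmx_sumr !raddf_sum; apply: eq_bigr => i _ /=.
  rewrite mulmx_sumr !raddf_sum; apply: eq_bigr => j _ /=.
  exact: mcoeff_trpoly.
move: (\sum_i _) (torus_char W) => p chi pE chiE.
by rewrite mcoeffZ chiE pE casE mul_mx_scalar linearZ.
Qed.

End TracePolynomials.

Section WeylCharacterFormula.
Variables (R : realType) (r : nat).
Local Notation C := (complex R).

Lemma map_alternant (al : 'I_r -> nat) :
  map_mpoly ratr (alternant (fun i => 'X_i : {mpoly rat[r]}) al)
  = alternant (fun i => 'X_i : {mpoly C[r]}) al.
Proof.
rewrite /alternant -det_map_mx; congr (\det _); apply/matrixP => i j.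
by rewrite !mxE rmorphXn /= map_mpolyX.
Qed.

Lemma Char_rep_alternant (W : polyrep R r) lam :
    irreducible_rep W -> has_highest_weight W lam ->
    (forall i j : 'I_r, (i <= j)%N -> (lam j <= lam i)%N) ->
  Char_rep W * alternant (fun i => 'X_i) (@staircase r)
  = alternant (fun i => 'X_i) (shifted lam).
Proof.
move=> irrW [w [nz_w lam_w up_w]] lam_dec.
have weyl : torus_char W * alternant (fun i => 'X_i) (@staircase r)
    = alternant (fun i => 'X_i) (shifted lam).
  apply: (weyl_character (Y := fun i j => trpoly (lie_unit W i j *m lie_unit W j i))
    (c := casimir_scalar R lam)).
  - exact: msym_torus_char.
  - exact: lam_dec.
  - exact: trpoly_swap.
  - exact: trpoly_comm.
  - exact: trpoly_diag.
  - exact/trpoly_casimir/(casimirE irrW nz_w).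
  - move=> l; rewrite mcoeff_torus_char => nz_l.
    have := @wproj_eq0 _ _ W lam w irrW nz_w lam_w up_w l.
    case: forallP => [dom|_] /=.
      case: eqP => [-> _|_ /(_ isT) wl]; last by rewrite wl mxtrace0 eqxx in nz_l.
      split=> // k; have [kr|rk] := leqP k r.
        by have := dom (inord k); rewrite inordK.
      have full (m : 'X_{1..r}) : psum m k = psum m r :> nat.
        by apply: eq_bigl => i; rewrite (ltn_trans (ltn_ord i) rk) ltn_ord.
      by rewrite !full; have := dom ord_max.
    by move=> /(_ isT) wl; rewrite wl mxtrace0 eqxx in nz_l.
  - by rewrite mcoeff_torus_char; exact: tr_wproj_hw irrW nz_w lam_w up_w.
apply: (@map_ratr_inj C).
have := map_Char_rep W; have := map_alternant (@staircase r).
have := map_alternant (shifted lam).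
move: (torus_char W) (Char_rep W) (alternant _ _) (alternant _ _) weyl.
move=> chi X b1 b0 weyl.
move: (alternant (fun i => 'X_i : {mpoly rat[r]}) (shifted lam)) => a1.
move: (alternant (fun i => 'X_i : {mpoly rat[r]}) (@staircase r)) => a0.
by move=> e1 e0 e; rewrite rmorphM /= e e0 e1.
Qed.

End WeylCharacterFormula.

(** * Jacobi-Trudi determinants *)

Lemma sum_truncate (A : nmodType) (F : nat -> A) n m : (n <= m)%N ->
    (forall k, (n <= k)%N -> F k = 0) ->
  \sum_(k < m) F k = \sum_(k < n) F k.
Proof.
move=> nm F0; rewrite (big_ord_widen m F nm) [RHS]big_mkcond.
by apply: eq_bigr => k _; case: ltnP => // /F0.
Qed.

Section SymmetricFunctions.
Variables (A : comNzRingType) (r : nat) (x : 'I_r -> A).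

(** The generating polynomial of the elementary symmetric functions, so that
    [elem k] is (-1)^k e_k. *)
Definition elem_poly : {poly A} := \prod_i (1 - x i *: 'X).
Definition elem k : A := elem_poly`_k.
Definition power_sum k : A := \sum_i x i ^+ k.

(** The generating polynomial of the variables other than x l. *)
Definition elem_poly_but l : {poly A} := \prod_(i | i != l) (1 - x i *: 'X).

Lemma elem0 : elem 0 = 1.
Proof.
rewrite /elem /elem_poly -horner_coef0 horner_prod big1 // => i _.
by rewrite !hornerE ?mulr0 ?oppr0 ?addr0.
Qed.

Lemma size_elem_factor i : (size (1 - x i *: 'X)%R <= 2)%N.
Proof.
rewrite (leq_trans (size_polyD _ _)) // size_polyN geq_max size_poly1 /=.
by rewrite (leq_trans (size_scale_leq _ _)) // size_polyX.
Qed.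

Lemma elem_out k : (r < k)%N -> elem k = 0.
Proof.
move=> rk; apply: nth_default; apply: leq_trans rk.
apply: (leq_trans (size_prod_leq _ _)).
have : (\sum_(i < r) size (1 - x i *: 'X)%R <= \sum_(i < r) 2)%N.
  by apply: leq_sum => i _; exact: size_elem_factor.
rewrite sum_nat_const card_ord muln2 -addnn => h.
by rewrite leq_subLR addnS ltnS.
Qed.

Lemma elem_but_out l k : (r <= k)%N -> (elem_poly_but l)`_k = 0.
Proof.
move=> rk; apply: nth_default; apply: leq_trans rk.
apply: (leq_trans (size_prod_leq _ _)).
have : (\sum_(i < r | i != l) size (1 - x i *: 'X)%R <= \sum_(i < r | i != l) 2)%N.
  by apply: leq_sum => i _; exact: size_elem_factor.
have cE : #|[pred i | i != l]| = r.-1 by rewrite cardC1 card_ord.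
rewrite sum_nat_const cE muln2 -addnn => h.
rewrite leq_subLR; apply: leq_ltn_trans h _.
by have := ltn_ord l; lia.
Qed.

Lemma elem_but_rec l k :
  elem k = (elem_poly_but l)`_k - x l * (if k is k'.+1 then (elem_poly_but l)`_k' else 0).
Proof.
rewrite /elem /elem_poly (bigD1 l) //= mulrBl mul1r coefB -scalerAl coefZ.
by rewrite coefXM; case: k.
Qed.

Lemma elem_but0 l : (elem_poly_but l)`_0 = 1.
Proof. by have := elem_but_rec l 0; rewrite elem0 mulr0 subr0 => <-. Qed.

Lemma elem_but_expand l k :
  (elem_poly_but l)`_k = \sum_(j < k.+1) x l ^+ j * elem (k - j).
Proof.
elim: k => [|k IHk]; first by rewrite big_ord1 elem_but0 elem0 mulr1.
rewrite big_ord_recl /= subn0 mul1r (elem_but_rec l k.+1) IHk big_distrr.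
rewrite -addrA -[LHS]addr0; congr (_ + _); apply/esym/eqP.
rewrite addrC subr_eq0; apply/eqP; apply: eq_bigr => j _.
by rewrite /= mulrA -exprS.
Qed.

(** Newton's identities, from the derivative of the product [elem_poly]: its
    terms are the [elem_poly_but l], which expand in the [elem k] and the powers
    of x l. *)
Lemma newton_elem k :
  k.+1%:R * elem k.+1 = - \sum_(j < k.+1) power_sum j.+1 * elem (k - j).
Proof.
have dE : elem_poly^`() = - \sum_i x i *: elem_poly_but i.
  rewrite /elem_poly (@derivation_prod _ deriv) ?index_enum_uniq //.
  - rewrite -sumrN; apply: eq_bigr => i _.
    rewrite derivB derivZ derivX -[1]polyC1 derivC sub0r polyC1 mulNr.
    by rewrite alg_polyC mul_polyC.
  - by rewrite -[1]polyC1 derivC.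
  - exact: derivM.
have := congr1 (fun p : {poly A} => p`_k) dE.
rewrite /= coef_deriv coefN coef_sum mulr_natl => ->; congr (- _).
transitivity (\sum_i \sum_(j < k.+1) x i * (x i ^+ j * elem (k - j))).
  by apply: eq_bigr => i _; rewrite coefZ elem_but_expand big_distrr.
rewrite exchange_big; apply: eq_bigr => j _; rewrite /power_sum big_distrl.
by apply: eq_bigr => i _ /=; rewrite mulrA -exprS.
Qed.

(** The complete symmetric functions h_m, ..., h_0, computed by inverting the
    series of the [elem k]. *)
Fixpoint complete_seq m : seq A :=
  if m is m'.+1 then
    let s := complete_seq m' in
    (- \sum_(j < m) s`_j * elem j.+1) :: s
  else [:: 1].

Definition complete m : A := (complete_seq m)`_0.

Lemma complete_seqE m j : (j <= m)%N -> (complete_seq m)`_j = complete (m - j).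
Proof.
by elim: m j => [|m IHm] [|j] //; rewrite ltnS subSS => /IHm <-.
Qed.

Lemma completeS m :
  complete m.+1 = - \sum_(j < m.+1) complete (m - j) * elem j.+1.
Proof.
rewrite {1}/complete /=; congr (- _); apply: eq_bigr => j _.
by rewrite complete_seqE // -ltnS.
Qed.

Lemma complete_elem m :
  \sum_(j < m.+1) complete (m - j) * elem j = (m == 0%N)%:R.
Proof.
case: m => [|m]; first by rewrite big_ord1 elem0 mulr1.
rewrite big_ord_recl elem0 mulr1 subn0 completeS; apply/eqP.
by rewrite addrC subr_eq0; apply/eqP/eq_bigr => j _; rewrite subSS.
Qed.

(** The product of the series of the h_m with [elem_poly_but l] is the geometric
    series of x l. *)
Lemma complete_elem_but l m :
  \sum_(j < m.+1) complete (m - j) * (elem_poly_but l)`_j = x l ^+ m.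
Proof.
elim: m => [|m IHm]; first by rewrite big_ord1 elem_but0 mulr1.
have := complete_elem m.+1.
under eq_bigr do rewrite (elem_but_rec l) mulrBr.
rewrite sumrB [X in _ - X]big_ord_recl /= !mulr0 add0r => /eqP.
rewrite subr_eq0 => /eqP ->; rewrite exprS -IHm big_distrr.
by apply: eq_bigr => j _ /=; rewrite subSS mulrCA.
Qed.

(** The function h_(a - b), which is zero for a < b. *)
Definition complete_diff a b : A := if (b <= a)%N then complete (a - b) else 0.

Lemma complete_diff_sum B m (c : nat -> A) :
    (forall k, (B <= k)%N -> c k = 0) ->
  \sum_(k < B) complete_diff m k * c k = \sum_(k < m.+1) complete (m - k) * c k.
Proof.
move=> c0; transitivity (\sum_(k < B + m.+1) complete_diff m k * c k).
  rewrite [RHS](@sum_truncate _ (fun k => complete_diff m k * c k) B) ?leq_addr //.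
  by move=> k /c0 ->; rewrite mulr0.
rewrite (@sum_truncate _ (fun k => complete_diff m k * c k) m.+1) ?leq_addl //.
  by apply: eq_bigr => k _; rewrite /complete_diff -ltnS ltn_ord.
by move=> k mk; rewrite /complete_diff leqNgt mk mul0r.
Qed.

Definition jacobi_trudi n (al : nat -> nat) : 'M[A]_n :=
  \matrix_(i, j) complete_diff (al i + j) i.

Lemma det_unitriangular n (M : 'M[A]_n) :
  (forall i j : 'I_n, (j < i)%N -> M i j = 0) -> (forall i, M i i = 1) ->
  \det M = 1.
Proof.
move=> M0 M1; rewrite -det_tr det_trig; last first.
  by apply/is_trig_mxP => i j ij; rewrite mxE M0.
by rewrite big1 // => i _; rewrite mxE M1.
Qed.

Lemma det_jacobi_trudi0 n : \det (jacobi_trudi n (fun=> 0%N)) = 1.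
Proof.
apply: det_unitriangular => [i j ji|i]; rewrite mxE /complete_diff.
  by rewrite leqNgt ji.
by rewrite add0n leqnn subnn.
Qed.

(** By [complete_elem_but], the matrix of the powers x_l^(al_i + delta_i) is the
    product of a matrix that does not depend on al with the transpose of the
    Jacobi-Trudi matrix; for al = 0 the latter is unitriangular, which gives the
    determinant of the former. *)
Lemma alternant_jacobi_trudi (al : nat -> nat) :
  alternant x (fun i => al i + staircase i)%N
  = alternant x (@staircase r) * \det (jacobi_trudi r al).
Proof.
pose E : 'M[A]_r := \matrix_(l, j) (elem_poly_but l)`_(rev_ord j).
have fact (be : nat -> nat) : alternant x (fun i => be i + staircase i)%N
    = \det E * \det (jacobi_trudi r be).
  rewrite -[\det (jacobi_trudi _ _)]det_tr -det_mulmx; congr (\det _).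
  apply/matrixP => l i; rewrite !mxE -(complete_elem_but l) -(complete_diff_sum (B := r)).
    rewrite (reindex_inj rev_ord_inj); apply: eq_bigr => j _.
    rewrite !mxE mulrC; congr (_ * _); rewrite /complete_diff /staircase /=.
    have := ltn_ord i; have := ltn_ord j => jr ir.
    have -> : (r - j.+1 <= be i + (r - i.+1))%N = (i <= be i + j)%N by lia.
    by case: ifP => // h; congr complete; lia.
  by move=> k; exact: elem_but_out.
rewrite fact; congr (_ * _).
by have := fact (fun=> 0%N); rewrite det_jacobi_trudi0 mulr1 => <-.
Qed.

(** The zero parts add a unitriangular diagonal block, with zeros below the
    main block. *)
Lemma det_jacobi_trudi_pad n m (al : nat -> nat) :
    (forall i, (n <= i)%N -> al i = 0%N) ->
  \det (jacobi_trudi (n + m) al) = \det (jacobi_trudi n al).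
Proof.
move=> al0; rewrite -[jacobi_trudi (n + m) al]submxK.
have -> : dlsubmx (jacobi_trudi (n + m) al) = 0.
  apply/matrixP => i j; rewrite !mxE /= al0 ?leq_addr // /complete_diff.
  by rewrite leqNgt (leq_trans (ltn_ord j)) // leq_addr.
rewrite det_ublock [X in _ * X]det_unitriangular ?mulr1.
- by congr (\det _); apply/matrixP => i j; rewrite !mxE.
- move=> i j ji; rewrite !mxE /= al0 ?leq_addr // /complete_diff.
  by rewrite add0n leq_add2l leqNgt ji.
- move=> i; rewrite !mxE /= al0 ?leq_addr // /complete_diff.
  by rewrite add0n leqnn subnn.
Qed.

(** The vector of the elem k, in reverse order, is in the kernel: with fewer
    than n variables, its product with a row is the complete convolution of the
    h_m with the elem k, in positive degree. Its last entry is 1. *)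
Lemma det_jacobi_trudi_vanish n (al : nat -> nat) : (r < n)%N ->
  (forall i, (i < n)%N -> (0 < al i)%N) -> \det (jacobi_trudi n al) = 0.
Proof.
move=> rn al_pos; pose v : 'cV[A]_n := \col_j elem (rev_ord j).
have Mv : jacobi_trudi n al *m v = 0.
  apply/colP => i; rewrite !mxE; have in_ := ltn_ord i.
  have := complete_elem (al i + (n - i.+1)); rewrite addn_eq0.
  rewrite eqn0Ngt al_pos //= => e; rewrite -[RHS]e.
  rewrite -(complete_diff_sum (B := n)).
    rewrite (reindex_inj rev_ord_inj); apply: eq_bigr => j _.
    rewrite !mxE rev_ordK; congr (_ * _); rewrite /complete_diff /=.
    have jn := ltn_ord j.
    have -> : (i <= al i + (n - j.+1))%N = (j <= al i + (n - i.+1))%N by lia.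
    by case: ifP => // h; congr complete; lia.
  by move=> k nk; apply: elem_out; exact: leq_trans nk.
have := congr1 (mulmx (\adj (jacobi_trudi n al))) Mv.
case: n => [|n] in rn al_pos v Mv *; first by rewrite ltn0 in rn.
rewrite mulmxA mul_adj_mx mul_scalar_mx mulmx0.
move/(congr1 (fun w : 'cV_n.+1 => w ord_max 0)).
by rewrite !mxE /= subnn elem0 mulr1.
Qed.

End SymmetricFunctions.

(** * Multiplicativity of the Chern character *)

Section Truncation.
Variables (K : comNzRingType) (n : nat).
Implicit Types (p q : {mpoly K[n]}) (m : 'X_{1..n}).

Lemma mcoeff_pihomog k p m :
  (pihomog mdeg k p)@_m = if mdeg m == k then p@_m else 0.
Proof.
have e : pihomog mdeg k p = \sum_(l <- msupp p) p@_l *: pihomog mdeg k 'X_[l].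
  rewrite [p in LHS]mpolyE (linear_sum (pihomog mdeg k)).
  by apply: eq_bigr => l _; exact: linearZ.
rewrite e [p in RHS]mpolyE !(raddf_sum (mcoeff m)).
have -> : (if mdeg m == k then \sum_(l <- msupp p) (p@_l *: 'X_[l])@_m else 0)
    = \sum_(l <- msupp p) if mdeg m == k then (p@_l *: 'X_[l])@_m else 0.
  by case: eqP => //; rewrite big1.
apply: eq_bigr => l _ /=; rewrite !mcoeffZ pihomogX mcoeffX.
have [->|lm] := eqVneq l m.
  by case: eqP; rewrite ?mcoeffX ?eqxx ?mcoeff0 ?mulr0.
by rewrite mulr0; case: ifP; rewrite ?mcoeffX ?(negbTE lm) ?mcoeff0 mulr0 if_same.
Qed.

Definition eq_upto k p q := forall m, (mdeg m <= k)%N -> p@_m = q@_m.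

Lemma eq_uptoD k p p' q q' :
  eq_upto k p p' -> eq_upto k q q' -> eq_upto k (p + q) (p' + q').
Proof. by move=> pp qq m mk; rewrite !mcoeffD pp ?qq. Qed.

Lemma eq_uptoM k p p' q q' :
  eq_upto k p p' -> eq_upto k q q' -> eq_upto k (p * q) (p' * q').
Proof.
move=> pp qq m mk; rewrite !mcoeffM; apply: eq_bigr => -[m1 m2] /= /eqP mE.
rewrite pp ?qq // (leq_trans _ mk) // -ltnS; exact: bmdeg.
Qed.

Lemma eq_upto_pihomog k p q : eq_upto k p q -> pihomog mdeg k p = pihomog mdeg k q.
Proof.
move=> pq; apply/mpolyP => m; rewrite !mcoeff_pihomog.
by case: eqP => // mk; rewrite pq ?mk.
Qed.

Lemma pihomogM k p q : pihomog mdeg k (p * q)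
  = \sum_(j < k.+1) pihomog mdeg j p * pihomog mdeg (k - j) q.
Proof.
apply/mpolyP => m; rewrite mcoeff_pihomog raddf_sum /=.
under eq_bigr do rewrite mcoeffM; rewrite exchange_big /= mcoeffM.
transitivity (\sum_(x : 'X_{1..n < (mdeg m).+1, (mdeg m).+1}
    | m == (x.1 + x.2)%MM) if mdeg m == k then p@_x.1 * q@_x.2 else 0).
  by case: eqP => //; rewrite big1.
apply: eq_bigr => -[m1 m2] /= /eqP mE.
have dE : mdeg m = (mdeg m1 + mdeg m2)%N by rewrite -mdegD -mE.
move: (bmnm m1) (bmnm m2) dE => {mE} {}m1 {}m2 dE.
under eq_bigr do rewrite !mcoeff_pihomog; rewrite dE.
case: eqP => [mk|mk]; last first.
  rewrite big1 // => j _; case: eqP => [jE|_]; last by rewrite mul0r.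
  case: eqP => [jE'|_]; last by rewrite mulr0.
  by case: mk; rewrite jE jE' subnKC // -ltnS.
have jk : (mdeg m1 < k.+1)%N by rewrite ltnS -mk leq_addr.
have kE : (k - mdeg m1 = mdeg m2)%N by rewrite -mk addKn.
rewrite (bigD1 (Ordinal jk)) //= eqxx kE eqxx big1 ?addr0 // => j.
by rewrite -val_eqE /= eq_sym => /negbTE ->; rewrite mul0r.
Qed.

Lemma eq_uptoX k p p' e : eq_upto k p p' -> eq_upto k (p ^+ e) (p' ^+ e).
Proof. by move=> pp; elim: e => // e IHe; rewrite !exprS; apply: eq_uptoM. Qed.

End Truncation.

Section Chern.
Variable r : nat.
Implicit Types p q : {mpoly rat[r]}.

(** The component of degree k of the substitution q_i |-> e^(a_i). *)
Definition chern k p := pihomog mdeg k (p \mPo [tuple exp_trunc k i | i < r]).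

Lemma chern_is_linear k : linear (chern k).
Proof. by move=> a p q; rewrite /chern !linearP. Qed.
HB.instance Definition _ k := GRing.isLinear.Build rat {mpoly rat[r]} {mpoly rat[r]} _
  (chern k) (chern_is_linear k).

Lemma exp_trunc_upto j k (i : 'I_r) : (j <= k)%N ->
  eq_upto j (exp_trunc k i) (exp_trunc j i).
Proof.
move=> jk m mj; rewrite /exp_trunc !raddf_sum /=.
pose F l := ((l`!%:R)^-1 *: ('X_i : {mpoly rat[r]}) ^+ l)@_m.
have F0 l : (j < l)%N -> F l = 0.
  move=> jl; rewrite /F mcoeffZ mpolyXn mcoeffX; case: eqP => [mE|_]; last exact: mulr0.
  by move: mj; rewrite -mE mdegMn mdeg1 mul1n leqNgt jl.
exact: (@sum_truncate _ F).
Qed.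

(** Truncating the exponential series beyond degree j does not change the
    components of degree at most j. *)
Lemma eq_upto_comp j k p : (j <= k)%N ->
  eq_upto j (p \mPo [tuple exp_trunc k i | i < r])
            (p \mPo [tuple exp_trunc j i | i < r]).
Proof.
move=> jk; rewrite !comp_mpolyEX; apply: big_ind2; [by []| |move=> m _].
  by move=> *; exact: eq_uptoD.
move=> m' m'j; rewrite !mcoeffZ; congr (_ * _); move: m' m'j.
rewrite !comp_mpolyX; apply: (big_ind2 (eq_upto j)); [by []| |move=> i _].
  by move=> *; exact: eq_uptoM.
by apply: eq_uptoX; rewrite !tnth_mktuple; exact: exp_trunc_upto.
Qed.

Lemma chernM k p q : chern k (p * q) = \sum_(j < k.+1) chern j p * chern (k - j) q.
Proof.
rewrite /chern rmorphM /= pihomogM; apply: eq_bigr => j _.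
have jk : (j <= k)%N by rewrite -ltnS.
rewrite (eq_upto_pihomog (eq_upto_comp p jk)).
by rewrite (eq_upto_pihomog (eq_upto_comp q (leq_subr j k))).
Qed.

Lemma chern1 k : chern k 1 = (k == 0%N)%:R.
Proof.
rewrite /chern rmorph1 -[X in pihomog _ _ X]mpolyX0 pihomogX /= mdeg0 eq_sym.
by case: eqP; rewrite ?mpolyX0.
Qed.

Lemma chern_X k i : chern k 'X_i = (k`!%:R)^-1 *: 'X_i ^+ k.
Proof.
rewrite /chern comp_mpolyXU -tnth_nth tnth_mktuple /exp_trunc raddf_sum /=.
rewrite big_ord_recr /= big1 => [|j _]; rewrite linearZ /= mpolyXn pihomogX.
  by rewrite /= mdegMn mdeg1 mul1n eqxx add0r.
by rewrite /= mdegMn mdeg1 mul1n (ltn_eqF (ltn_ord j)) scaler0.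
Qed.

End Chern.

Section ChernForm.
Variable A : comNzRingType.
Implicit Types (T u v P Q S : A) (c : nat -> A).

(** This says that the first four terms of c are those of
    e^(d T) (P + Q u / 2 + S v / 6), where T, u and v have degrees 1, 2 and 3.
    Denominators are cleared so that the form makes sense in every ring. *)
Definition chern_form T u v (d : nat) P Q S c :=
  [/\ c 0%N = P, c 1%N = d%:R * P * T,
      2%:R * c 2%N = Q * u + d%:R ^+ 2 * P * T ^+ 2 &
      6%:R * c 3%N = S * v + 3%:R * d%:R * Q * T * u + d%:R ^+ 3 * P * T ^+ 3].

Lemma chern_formM T u v d d' P Q S P' Q' S' c c' c'' :
    chern_form T u v d P Q S c -> chern_form T u v d' P' Q' S' c' ->
    (forall k, c'' k = \sum_(j < k.+1) c j * c' (k - j)%N) ->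
  chern_form T u v (d + d') (P * P') (P * Q' + Q * P') (P * S' + S * P') c''.
Proof.
move=> [c0 c1 c2 c3] [c0' c1' c2' c3'] cE.
split; rewrite cE !(big_ord_recl, big_ord0) /= ?subn0 ?subnn ?addr0.
- by rewrite c0 c0'.
- by rewrite c0 c1 c0' c1' natrD; ring.
- rewrite (_ : 2%:R * _ = c 0%N * (2%:R * c' 2%N) + 2%:R * (c 1%N * c' 1%N)
    + (2%:R * c 2%N) * c' 0%N); last by rewrite /bump /=; ring.
  by rewrite c0 c1 c2 c0' c1' c2' natrD; ring.
- rewrite (_ : 6%:R * _ = c 0%N * (6%:R * c' 3%N) + 3%:R * (c 1%N * (2%:R * c' 2%N))
    + 3%:R * ((2%:R * c 2%N) * c' 1%N) + (6%:R * c 3%N) * c' 0%N); last first.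
    by rewrite /bump /=; ring.
  by rewrite c0 c1 c2 c3 c0' c1' c2' c3' natrD; ring.
Qed.

End ChernForm.

(** * Uniformity in the rank *)

Section FixedRank.
Variable r : nat.
Local Notation P_ := {mpoly rat[r]}.

Definition vars : 'I_r -> P_ := fun i => 'X_i.
(** The mean of the variables. The central forms [central2] and [central3] are
    the second and third power sums of the deviations from this mean. *)
Definition mean_var : P_ := (r%:R)^-1 *: power_sum vars 1.
Definition central2 : P_ := power_sum vars 2 - r%:R * mean_var ^+ 2.
Definition central3 : P_ :=
  power_sum vars 3 - 3%:R * mean_var * central2 - r%:R * mean_var ^+ 3.

Definition rank_form d (p : P_) (a b c : rat) :=
  chern_form mean_var central2 central3 d a%:MP b%:MP c%:MP (fun k => chern k p).

(** A variable q_i = e^(a_i) is a pure exponential. *)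
Lemma chern_form_var i :
  chern_form ('X_i : P_) 0 0 1 1 0 0 (fun k => chern k 'X_i).
Proof.
have fact_inv k (x : P_) : k%:R != 0 :> rat -> k%:R * (k%:R^-1 *: x) = x.
  by move=> k0; rewrite mulr_natl -scaler_nat scalerA mulfV // scale1r.
split; rewrite chern_X ?fact_inv //.
- by rewrite expr0 fact0 invr1 scale1r.
- by rewrite expr1 invr1 scale1r !mul1r.
- by rewrite mul0r add0r expr1n !mul1r.
- by rewrite !mul0r !mulr0 !add0r expr1n !mul1r.
Qed.

Lemma chern_form_varX i m :
  chern_form ('X_i : P_) 0 0 m 1 0 0 (fun k => chern k ('X_i ^+ m)).
Proof.
elim: m => [|m IHm].
  by split; rewrite expr0 chern1 /= ?mul0r ?mulr0 ?expr0n /= ?mul0r ?addr0.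
have := chern_formM (chern_form_var i) IHm (c'' := fun k => chern k ('X_i ^+ m.+1)).
rewrite !mulr0 !mul0r !addr0 mulr1 add1n; apply=> k.
by rewrite exprS chernM.
Qed.

Lemma rank_form_power_sum m : (0 < r)%N ->
  rank_form m (power_sum vars m) r%:R (m%:R ^+ 2) (m%:R ^+ 3).
Proof.
move=> r0; have rT : r%:R * mean_var = power_sum vars 1.
  rewrite mulr_natl /mean_var -scaler_nat scalerA mulfV ?scale1r //.
  by rewrite pnatr_eq0 -lt0n.
have cE k : chern k (power_sum vars m) = \sum_i chern k ('X_i ^+ m).
  exact: linear_sum.
have natMP (a : nat) : (a%:R : rat)%:MP = a%:R :> P_ by exact: mpolyC_nat.
have natXMP (a e : nat) : ((a%:R : rat) ^+ e)%:MP = a%:R ^+ e :> P_.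
  by rewrite rmorphXn /= natMP.
split; rewrite cE.
- rewrite (eq_bigr (fun=> 1)) => [|i _]; last by case: (chern_form_varX i m).
  by rewrite sumr_const card_ord natMP.
- rewrite natMP -mulrA rT /power_sum big_distrr; apply: eq_bigr => i _ /=.
  by case: (chern_form_varX i m) => _ -> _ _; rewrite mulr1 expr1.
- rewrite natMP natXMP /central2 -mulrA; set q := power_sum vars 2.
  rewrite (_ : _ + _ = m%:R ^+ 2 * q); last by ring.
  rewrite /q /power_sum !big_distrr; apply: eq_bigr => i _ /=.
  by case: (chern_form_varX i m) => _ _ -> _; rewrite mul0r add0r mulr1.
- rewrite natMP !natXMP /central3; set q := power_sum vars 3.
  rewrite (_ : _ + _ = m%:R ^+ 3 * q); last by ring.
  rewrite /q /power_sum !big_distrr; apply: eq_bigr => i _ /=.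
  case: (chern_form_varX i m) => _ _ _ ->.
  by rewrite mul0r !mulr0 !add0r mulr1.
Qed.

Lemma rank_form1 : rank_form 0 1 1 0 0.
Proof.
split; rewrite chern1 ?mpolyC1 ?mpolyC0 /= ?mul0r ?mulr0 ?expr0n /= ?mul0r ?addr0 //.
Qed.

Lemma rank_form0 d : rank_form d 0 0 0 0.
Proof.
by split; rewrite linear0 mpolyC0 ?mulr0 ?mul0r ?addr0.
Qed.

Lemma rank_formD d p p' a b c a' b' c' :
  rank_form d p a b c -> rank_form d p' a' b' c' ->
  rank_form d (p + p') (a + a') (b + b') (c + c').
Proof.
move=> [/= p0 p1 p2 p3] [/= q0 q1 q2 q3]; split; rewrite linearD /= !mpolyCD.
- by rewrite p0 q0.
- by rewrite p1 q1; ring.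
- by rewrite mulrDr p2 q2; ring.
- by rewrite mulrDr p3 q3; ring.
Qed.

Lemma rank_formZ d p a b c e : rank_form d p a b c ->
  rank_form d (e *: p) (e * a) (e * b) (e * c).
Proof.
move=> [/= p0 p1 p2 p3]; split; rewrite linearZ /= -mul_mpolyC !mpolyCM.
- by rewrite p0.
- by rewrite p1; ring.
- by rewrite mulrCA p2; ring.
- by rewrite mulrCA p3; ring.
Qed.

Lemma rank_formM d d' p p' a b c a' b' c' :
  rank_form d p a b c -> rank_form d' p' a' b' c' ->
  rank_form (d + d') (p * p') (a * a') (a * b' + b * a') (a * c' + c * a').
Proof.
move=> pf qf; have := chern_formM pf qf (fun k => chernM k p p').
by rewrite /rank_form !mpolyCD !mpolyCM.
Qed.

End FixedRank.

(** A polynomial in q_1, ..., q_r for every rank r. *)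
Definition family := forall r, {mpoly rat[r]}.

(** The families whose Chern characters have the form of [chern_form] with
    coefficients polynomial in the rank. The bounds on the degrees of b and c
    are one less than on that of a, and are stable under products because each
    term of a b' + b a' contains exactly one of b and b'. *)
Definition uniform d (F : family) := exists a b c : {poly rat},
  [/\ (size a <= d.+1)%N, (size b <= d)%N, (size c <= d)%N &
      forall r, (0 < r)%N -> rank_form d (F r) a.[r%:R] b.[r%:R] c.[r%:R]].

Lemma uniform_ext d (F G : family) : (forall r, F r = G r) -> uniform d F -> uniform d G.
Proof.
move=> FG [a [b [c [sa sb sc h]]]]; exists a, b, c; split=> // r r0.
by rewrite -FG; exact: h.
Qed.

Lemma uniform0 d : uniform d (fun=> 0).
Proof.
exists 0, 0, 0; rewrite size_poly0; split=> // r _; rewrite !horner0.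
exact: rank_form0.
Qed.

Lemma uniform1 : uniform 0 (fun=> 1).
Proof.
exists 1, 0, 0; rewrite size_poly0 size_poly1; split=> // r _.
by rewrite !hornerE; exact: rank_form1.
Qed.

Lemma uniformD d (F G : family) : uniform d F -> uniform d G ->
  uniform d (fun r => F r + G r).
Proof.
move=> [a [b [c [sa sb sc h]]]] [a' [b' [c' [sa' sb' sc' h']]]].
exists (a + a'), (b + b'), (c + c').
split; try by rewrite (leq_trans (size_polyD _ _)) // geq_max ?sa ?sb ?sc.
by move=> r r0; rewrite !hornerD; apply: rank_formD; [exact: h | exact: h'].
Qed.

Lemma uniformZ d (F : family) e : uniform d F -> uniform d (fun r => e *: F r).
Proof.
move=> [a [b [c [sa sb sc h]]]]; exists (e *: a), (e *: b), (e *: c).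
split; try exact: leq_trans (size_scale_leq _ _) _.
by move=> r r0; rewrite !hornerZ; apply: rank_formZ; exact: h.
Qed.

Lemma uniformM d d' (F G : family) : uniform d F -> uniform d' G ->
  uniform (d + d') (fun r => F r * G r).
Proof.
move=> [a [b [c [sa sb sc h]]]] [a' [b' [c' [sa' sb' sc' h']]]].
exists (a * a'), (a * b' + b * a'), (a * c' + c * a').
have szM (p q : {poly rat}) m : ((size p + size q).-1 <= m)%N -> (size (p * q)%R <= m)%N.
  exact: leq_trans (size_polyMleq _ _).
split; try (rewrite (leq_trans (size_polyD _ _)) // geq_max; apply/andP; split);
  try (apply: szM; lia).
by move=> r r0; rewrite !hornerD !hornerM; apply: rank_formM; [exact: h | exact: h'].
Qed.

Lemma uniform_sum (I : eqType) (s : seq I) d (F : I -> family) :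
  (forall i, i \in s -> uniform d (F i)) -> uniform d (fun r => \sum_(i <- s) F i r).
Proof.
elim: s => [|i s IHs] Fs.
  by apply: uniform_ext (uniform0 d) => r; rewrite big_nil.
have Us : uniform d (fun r => \sum_(i <- s) F i r).
  by apply: IHs => j js; apply: Fs; rewrite inE js orbT.
apply: uniform_ext (uniformD (Fs i (mem_head _ _)) Us) => r.
by rewrite big_cons.
Qed.

Lemma uniform_prod (I : Type) (s : seq I) (dg : I -> nat) (F : I -> family) :
  (forall i, uniform (dg i) (F i)) ->
  uniform (\sum_(i <- s) dg i) (fun r => \prod_(i <- s) F i r).
Proof.
move=> Fs; elim: s => [|i s IHs].
  by rewrite big_nil; apply: uniform_ext uniform1 => r; rewrite big_nil.
rewrite big_cons; apply: uniform_ext (uniformM (Fs i) IHs) => r.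
by rewrite big_cons.
Qed.

Lemma uniform_power_sum m : (0 < m)%N -> uniform m (fun r => power_sum (@vars r) m).
Proof.
move=> m0; exists 'X, (m%:R ^+ 2)%:P, (m%:R ^+ 3)%:P.
rewrite size_polyX !(leq_trans (size_polyC_leq1 _)) //; split=> // r r0.
by rewrite hornerX !hornerC; exact: rank_form_power_sum.
Qed.

Lemma uniform_elem k : uniform k (fun r => elem (@vars r) k).
Proof.
elim/ltn_ind: k => -[_|k IHk].
  by apply: uniform_ext uniform1 => r; rewrite elem0.
have U : uniform k.+1 (fun r => \sum_(j <- index_enum 'I_k.+1)
    power_sum (@vars r) j.+1 * elem (@vars r) (k - j)).
  apply: uniform_sum => j _.
  have kE : (j.+1 + (k - j) = k.+1)%N by rewrite addSn subnKC // -ltnS.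
  rewrite -[X in uniform X _]kE.
  apply: uniformM; first exact: uniform_power_sum.
  by apply: IHk; rewrite ltnS leq_subr.
apply: uniform_ext (uniformZ (- (k.+1%:R)^-1) U) => r.
rewrite scaleNr -scalerN -newton_elem mulr_natl -scaler_nat scalerA.
by rewrite mulVf ?scale1r // pnatr_eq0.
Qed.

Lemma uniform_complete m : uniform m (fun r => complete (@vars r) m).
Proof.
elim/ltn_ind: m => -[_|m IHm]; first exact: uniform1.
have U : uniform m.+1 (fun r => \sum_(j <- index_enum 'I_m.+1)
    complete (@vars r) (m - j) * elem (@vars r) j.+1).
  apply: uniform_sum => j _.
  have mE : ((m - j) + j.+1 = m.+1)%N by rewrite addnS subnK // -ltnS.
  rewrite -[X in uniform X _]mE.
  apply: uniformM; last exact: uniform_elem.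
  by apply: IHm; rewrite ltnS leq_subr.
apply: uniform_ext (uniformZ (-1) U) => r.
by rewrite completeS scaleN1r.
Qed.

Definition schur_poly (al : seq nat) : family :=
  fun r => \det (jacobi_trudi (@vars r) (size al) (nth 0%N al)).

(** In the Leibniz formula each nonzero term is a product of functions h_m whose
    degrees add up to the sum of al: the shifts s i - i cancel. *)
Lemma uniform_schur_poly al : uniform (sumn al) (schur_poly al).
Proof.
apply: (@uniform_sum _ (index_enum 'S_(size al))) => s _.
apply: (@uniform_ext _ (fun r => (-1) ^+ s *:
    \prod_(i <- index_enum 'I_(size al))
      complete_diff (@vars r) (nth 0%N al i + s i) i)) => [r|].
  rewrite -mul_mpolyC rmorphXn rmorphN rmorph1; congr (_ * _).
  by apply: eq_bigr => i _; rewrite mxE.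
apply: uniformZ.
have [/forallP le_s|] := boolP [forall i : 'I_(size al), (i <= nth 0 al i + s i)%N].
  have -> : sumn al = (\sum_(i <- index_enum 'I_(size al)) (nth 0 al i + s i - i))%N.
    rewrite sumnB => [|i _]; last exact: le_s.
    have sE : (\sum_(i < size al) s i = \sum_(i < size al) i)%N.
      by rewrite [RHS](reindex_inj (@perm_inj _ s)).
    by rewrite big_split /= sE addnK sumnE (big_nth 0%N) big_mkord.
  apply: uniform_prod => i.
  by apply: uniform_ext (uniform_complete _) => r; rewrite /complete_diff le_s.
rewrite negb_forall => /existsP[i Ni]; apply: uniform_ext (uniform0 _) => r.
by rewrite (bigD1 i) //= /complete_diff (negbTE Ni) mul0r.
Qed.

Lemma alternant_staircase_neq0 r : alternant (@vars r) (@staircase r) != 0.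
Proof.
apply/eqP => a0; have := mcoeff_alternant_id rat (decr_inj (@staircase_decr r)).
by rewrite -/(@vars r) a0 mcoeff0 => /esym/eqP; rewrite oner_eq0.
Qed.

Section Schur.
Variables (R : realType) (r : nat).

(** Divide the Weyl character formula by the Vandermonde determinant, and remove
    the zero parts of the highest weight. *)
Lemma Char_rep_schur (al : seq nat) (W : polyrep R r) :
    sorted geq al -> (size al <= r)%N -> is_schur al W ->
  Char_rep W = schur_poly al r.
Proof.
move=> al_sorted al_r [irrW hwW].
apply: (mulIf (alternant_staircase_neq0 r)).
rewrite [LHS](Char_rep_alternant irrW hwW) => [|i j ij]; last first.
  rewrite !mnmE; have [ja|aj] := ltnP j (size al); last by rewrite nth_default.
  apply: (sorted_leq_nth _ _ _ al_sorted) => //.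
  - by move=> x y z xy zx; apply: leq_trans zx xy.
  - exact: leqnn.
  - by rewrite inE (leq_ltn_trans ij).
transitivity (alternant (@vars r) (fun i => nth 0 al i + staircase i)%N).
  by congr (\det _); apply/matrixP => i j; rewrite !mxE /shifted mnmE.
rewrite alternant_jacobi_trudi mulrC; congr (_ * _).
have pad N : N = (size al + (r - size al))%N ->
    \det (jacobi_trudi (@vars r) N (nth 0%N al)) = schur_poly al r.
  by move=> ->; apply: det_jacobi_trudi_pad => i; exact: nth_default.
by apply: pad; rewrite subnKC.
Qed.

(** Partitions with more than r parts are absent from the expansion of U, and
    contribute zero to the right-hand side. *)
Lemma Char_schur_expansion (d : nat) (u : seq (rat * seq nat)) (U : vrep R r) :
    (forall x, x \in u -> partition_of d x.2) -> schur_expansion u U ->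
  Char U = \sum_(x <- u) x.1 *: schur_poly x.2 r.
Proof.
move=> u_part [S [schurS /Char_groth ->]].
rewrite /Char big_map big_filter big_mkcond; apply: eq_big_seq => x xu /=.
have /and3P[x_sorted x_pos _] := u_part x xu.
case: leqP => [xr|rx]; first by rewrite (Char_rep_schur x_sorted xr) //; exact: schurS.
rewrite /schur_poly det_jacobi_trudi_vanish ?scaler0 // => i ix.
by rewrite lt0n; apply: contraNneq x_pos => <-; exact: mem_nth.
Qed.

End Schur.

(** The terms with mean_var cancel in Delta2, which is - a b times [central2]. *)
Lemma dlow2_rank_form (R : realType) r (U : vrep R r) d a b c :
    rank_form d (Char U) a b c -> ch0 U <> 0 ->
  dlow 2 U = - (2%:R^-1 * b) *: central2 r.
Proof.
move=> [c0 c1 c2 _] /eqP; rewrite /ch0.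
have -> : ch 0 U = a%:MP := c0.
rewrite mcoeffC eqxx mulr1 => nz; rewrite /dlow /ch0.
have -> : ch 0 U = a%:MP := c0.
have D2 : Delta2 U = - (a * b) *: central2 r.
  have -> : Delta2 U = ch 1 U ^+ 2 - ch 0 U * (2%:R * ch 2 U) 
    by rewrite /Delta2; move: (ch 0 U) (ch 1 U) (ch 2 U) => x y z; ring.
  have -> : ch 0 U = a%:MP := c0.
  have -> : ch 1 U = d%:R * a%:MP * mean_var r := c1.
  have -> : 2%:R * ch 2 U
      = b%:MP * central2 r + d%:R ^+ 2 * a%:MP * mean_var r ^+ 2 := c2.
  by rewrite -mul_mpolyC mpolyCN mpolyCM; ring.
rewrite /= D2 scalerA mcoeffC eqxx mulr1 expr1; congr (_ *: _).
by field.
Qed.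

(** The terms with mean_var cancel in Delta3, which is a^2 c / 2 times [central3]. *)
Lemma dlow3_rank_form (R : realType) r (U : vrep R r) d a b c :
    rank_form d (Char U) a b c -> ch0 U <> 0 ->
  dlow 3 U = (6%:R^-1 * c) *: central3 r.
Proof.
move=> [c0 c1 c2 c3] /eqP; rewrite /ch0.
have -> : ch 0 U = a%:MP := c0.
rewrite mcoeffC eqxx mulr1 => nz; rewrite /dlow /ch0.
have -> : ch 0 U = a%:MP := c0.
have D3 : 2%:R * Delta3 U = (a ^+ 2 * c) *: central3 r.
  have -> : 2%:R * Delta3 U = 2%:R * ch 1 U ^+ 3
      - 3%:R * ch 0 U * ch 1 U * (2%:R * ch 2 U)
      + ch 0 U ^+ 2 * (6%:R * ch 3 U) 
    by rewrite /Delta3; move: (ch 0 U) (ch 1 U) (ch 2 U) (ch 3 U) => x y z t; ring.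
  have -> : ch 0 U = a%:MP := c0.
  have -> : ch 1 U = d%:R * a%:MP * mean_var r := c1.
  have -> : 2%:R * ch 2 U
      = b%:MP * central2 r + d%:R ^+ 2 * a%:MP * mean_var r ^+ 2 := c2.
  have -> : 6%:R * ch 3 U
      = c%:MP * central3 r + 3%:R * d%:R * b%:MP * mean_var r * central2 r
    + d%:R ^+ 3 * a%:MP * mean_var r ^+ 3 := c3.
  by rewrite -mul_mpolyC mpolyCM rmorphXn /=; ring.
rewrite /= mcoeffC eqxx mulr1.
have -> : Delta3 U = 2%:R^-1 *: (2%:R * Delta3 U).
  by rewrite mulr_natl -scaler_nat scalerA mulVf // scale1r.
rewrite D3 !scalerA; congr (_ *: _); by field.
Qed.

Lemma rank_form_std_rep (R : realType) r : (0 < r)%N ->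
  rank_form 1 (Char [:: (1, std_rep R r)]) r%:R 1 1.
Proof.
move=> r0; have := rank_form_power_sum 1 r0; rewrite !expr1n.
suff -> : Char [:: (1, std_rep R r)] = power_sum (@vars r) 1 by [].
rewrite Char_cons Char_nil scale1r addr0 Char_std_rep.
by apply: eq_bigr => i _; rewrite expr1.
Qed.

Lemma ch0_std_rep (R : realType) r : (0 < r)%N -> ch0 [:: (1, std_rep R r)] <> 0.
Proof.
move=> r0; have [c0 _ _ _] := @rank_form_std_rep R r r0.
rewrite /ch0; have -> : ch 0 [:: (1, std_rep R r)] = r%:R%:MP := c0.
by rewrite mcoeffC eqxx mulr1; apply/eqP; rewrite pnatr_eq0 -lt0n.
Qed.

(* The element U of Rep_Q^d is given by its coefficients u on the Schur
   representations, which make sense for every r, so that f depends on u only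
   and is the same polynomial for all r. *)
Theorem theorem2p7 (R : realType) (d : nat) (u : seq (rat * seq nat))
    (hu : forall x, x \in u -> partition_of d x.2)
    (k : nat) (hk : k = 2%N \/ k = 3%N) :
  exists f : {poly rat},
    (size f <= d)%N /\
    forall (r : nat) (U : vrep R r),
      (1 <= r)%N -> schur_expansion u U -> ch0 U <> 0 ->
      dlow k U = f.[r%:R] *: dlow k [:: (1, std_rep R r)].
Proof.
have [a [b [c [_ sb sc F]]]] :
    uniform d (fun r => \sum_(x <- u) x.1 *: schur_poly x.2 r).
  apply: uniform_sum => x xu; apply: uniformZ.
  by have /and3P[_ _ /eqP <-] := hu x xu; exact: uniform_schur_poly.
have CharU r (U : vrep R r) : (1 <= r)%N -> schur_expansion u U ->
    rank_form d (Char U) a.[r%:R] b.[r%:R] c.[r%:R].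
  by move=> r1 uU; rewrite (Char_schur_expansion hu uU); exact: F.
case: hk => ->; [exists b | exists c]; split=> // r U r1 /(CharU r U r1) formU nzU.
  rewrite (dlow2_rank_form formU nzU).
  rewrite (dlow2_rank_form (@rank_form_std_rep R r r1) (@ch0_std_rep R r r1)) scalerA.
  by congr (_ *: _); ring.
rewrite (dlow3_rank_form formU nzU).
rewrite (dlow3_rank_form (@rank_form_std_rep R r r1) (@ch0_std_rep R r r1)) scalerA.
by congr (_ *: _); ring.
Qed.
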